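(* Let $d\ge 1$, $k\ge d+3$, and let $\mathfrak y$ be a topological subspace of $\mathfrak a_d^k$ with $\mathfrak g_d^k\subseteq \mathfrak y\subseteq \mathfrak r_d^k$. (A) If $\mathfrak y$ is not Hausdorff, then there are two shapes $[p],[q]\in\mathfrak y$ with $[p]\ne[q]$, a subset $I\subseteq\{1,\dots,k\}$ and an integer $j$ such that $(I,j)\in C(p)$ and $(I^c,d+1-j)\in C(q)$. (B) More precisely, $\mathfrak y$ is not Hausdorff if and only if there are two distinct shapes $[p],[q]\in\mathfrak y$ which, after a simultaneous reordering of rows (the same permutation of the $k$ landmarks applied to both), are represented by $k\times(d+1)$ matrices $P=(P_{rs})$ and $Q=(Q_{rs})$, $1\le r\le l$, $1\le s\le m$, partitioned into blocks in the same way (so $P_{rs}$ and $Q_{rs}$ have the same dimensions), and for which there are non-singular diagonal matrices $D_1,\dots,D_l$ and non-singular matrices $B_1,\dots,B_m$ of suitable sizes such that $$P=\begin{pmatrix} P_{11}&P_{12}&\cdots&P_{1m}\\ 0&\vdots&\ddots&\vdots\\ \vdots&P_{l-1,2}&\cdots&P_{l-1,m}\\ 0&\cdots&0&P_{lm}\end{pmatrix},\qquad Q=\begin{pmatrix} D_1P_{11}B_1&0&\cdots&0\\ Q_{21}&\cdots&Q_{2,m-1}&\vdots\\ \vdots&\ddots&\vdots&0\\ Q_{l1}&\cdots&Q_{l,m-1}&D_lP_{lm}B_m\end{pmatrix},$$ that is, $P_{r1}=0$ for $r\ge2$, $P_{ls}=0$ for $s\le m-1$, $Q_{1s}=0$ for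 $s\ge 2$, $Q_{rm}=0$ for $r\le l-1$, $Q_{11}=D_1P_{11}B_1$, $Q_{lm}=D_lP_{lm}B_m$, and: (i) $l,m>1$; (ii) if $P_{rs}\neq 0$ and $Q_{rs}\ne 0$, then $Q_{rs}=D_rP_{rs}B_s$; (iii) $P_{rs}=0$ if there is a pair $(a,b)\ne(r,s)$ with $a\le r$, $b\ge s$ and $Q_{ab}\ne0$; (iv) $Q_{rs}=0$ if there is a pair $(a,b)\neq(r,s)$ with $a\ge r$, $b\le s$ and $P_{ab}\neq0$.
   Context: $\mathbb{RP}^d$ is the space of lines through the origin in $\mathbb R^{d+1}$. The group $\mathrm{PGL}(d):=\mathrm{GL}(d+1,\mathbb R)/\mathbb R^*$ acts component-wise on $A_d^k=(\mathbb{RP}^d)^k$, and $\mathfrak a_d^k=A_d^k/\mathrm{PGL}(d)$ carries the quotient topology. A configuration $p\in A_d^k$ is represented by a real $k\times(d+1)$ matrix $P$ with non-zero rows (the $i$-th row being homogeneous coordinates of the $i$-th landmark), unique up to left multiplication by non-singular diagonal matrices. The shape $[p]=[P]$ is $\{DPB: D\in\mathrm{GL}(k,\mathbb R)\text{ diagonal},\ B\in\mathrm{GL}(d+1,\mathbb R)\}$. For $I\subseteq\{1,\dots,k\}$, $p_I$ is the restriction of $p$ to the landmarks with index in $I$, $\operatorname{rk}p_I$ is the rank of the corresponding rows of $P$, and $I^c=\{1,\dots,k\}\setminus I$. $\mathfrak g_d^k$ is the set of shapes of configurations in general position (any $d+1$ rows of $P$ are linearly independent). $\mathfrak r_d^k$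 is the set of shapes of configurations of full rank ($\operatorname{rk}P=d+1$). For $I\subseteq\{1,\dots,k\}$ and an integer $j$ with $1\le j<d+1$ and $|I|\ge j$, a configuration $p$ fulfills the projective subspace constraint $(I,j)$ if $\operatorname{rk}p_I\le j$. $C(p)$ is the set of all projective subspace constraints fulfilled by $p$; it depends only on the shape $[p]$. Blocks in a partition consist of a positive number of rows and columns. A topological subspace carries the subspace topology. *)

(* Defs.v *)
From HB Require Import structures.
From mathcomp Require Import all_boot all_order all_algebra all_fingroup.
From mathcomp Require Import generic_quotient.
From mathcomp Require Import all_classical all_reals all_analysis.

Set Implicit Arguments.
Unset Strict Implicit.
Unset Printing Implicit Defensive.

Import Order.TTheory GRing.Theory Num.Theory.
Import numFieldNormedType.Exports.

Local Open Scope classical_set_scope.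
Local Open Scope quotient_scope.
Local Open Scope ring_scope.

Section Configurations.
Variables (R : realType) (d : nat).

Definition nzvec : Type := set_type [set v : 'rV[R]_d.+1 | v != 0].
HB.instance Definition _ := Topological.on nzvec.

Definition same_line (u v : nzvec) : bool := (\val u == \val v)%MS.

Lemma same_line_refl : reflexive same_line.
Proof. by move=> u; apply/eqmxP. Qed.

Lemma same_line_sym : symmetric same_line.
Proof. by move=> u v; rewrite /same_line andbC. Qed.

Lemma same_line_trans : transitive same_line.
Proof.
move=> v u w /eqmxP uv /eqmxP vw; apply/eqmxP; exact: eqmx_trans uv vw.
Qed.

Canonical same_line_equiv :=
  EquivRel same_line same_line_refl same_line_sym same_line_trans.

Definition RP : Type := quotient_topology {eq_quot same_line}.
HB.instance Definition _ := Topological.on RP.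
HB.instance Definition _ := Quotient.on RP.

Lemma RP_eqP (u v : nzvec) : reflect (\pi_RP u = \pi_RP v) (same_line u v).
Proof. exact: (@eqmodP _ same_line_equiv u v). Qed.

Definition GL : Type := {B : 'M[R]_d.+1 | B \in unitmx}.

Lemma GL_act_subproof (g : GL) (v : nzvec) :
  \val v *m \val g \in [set w : 'rV[R]_d.+1 | w != 0].
Proof.
apply/mem_set => /=; apply/eqP => vg0.
have := set_mem (valP v); rewrite /= -(mulmxK (valP g) (\val v)).
by move/eqP; rewrite [X in X *m _]vg0 mul0mx.
Qed.

Definition nzvec_act (g : GL) (v : nzvec) : nzvec :=
  SigSub (GL_act_subproof g v).

(* Scalar matrices act trivially, so this is an action of PGL(d), which
   therefore has the same orbits as GL. *)
Definition RP_act (g : GL) (x : RP) : RP := \pi_RP (nzvec_act g (repr x)).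

Lemma RP_act_pi (g : GL) (v : nzvec) :
  RP_act g (\pi_RP v) = \pi_RP (nzvec_act g v).
Proof.
apply/RP_eqP; rewrite /same_line /=; apply/eqmxP/eqmxMr/eqmxP.
by apply/RP_eqP; rewrite reprK.
Qed.

Lemma RP_surj (x : RP) : exists v : nzvec, x = \pi_RP v.
Proof. by exists (repr x); rewrite reprK. Qed.

Variable k : nat.

Definition config : Type := {ptws 'I_k -> RP}.
HB.instance Definition _ := Topological.on config.

Definition config_act (g : GL) (p : config) : config :=
  fun i => RP_act g (p i).

Definition same_orbit (p q : config) : bool :=
  `[< exists g : GL, q = config_act g p >].

Lemma same_orbit_refl : reflexive same_orbit.
Proof.
move=> p; apply/asboolP; exists (exist _ 1%:M (unitmx1 _ _)).
apply/funext => i; rewrite /config_act; have [v ->] := RP_surj (p i); rewrite RP_act_pi.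
by congr (\pi_RP _); apply/val_inj; rewrite /= mulmx1.
Qed.

Lemma same_orbit_sym : symmetric same_orbit.
Proof.
suff H p q : same_orbit p q -> same_orbit q p.
  by move=> p q; apply/idP/idP; apply: H.
move=> /asboolP[g ->]; apply/asboolP.
have gVu : invmx (\val g) \in unitmx by rewrite unitmx_inv (valP g).
exists (exist _ (invmx (\val g)) gVu); apply/funext => i; rewrite /config_act /=.
have [v ->] := RP_surj (p i); rewrite !RP_act_pi.
by congr (\pi_RP _); apply/val_inj; rewrite /= mulmxK ?(valP g).
Qed.

Lemma same_orbit_trans : transitive same_orbit.
Proof.
move=> q p r /asboolP[g ->] /asboolP[h ->]; apply/asboolP.
have ghu : \val g *m \val h \in unitmx by rewrite unitmx_mul (valP g) (valP h).
exists (exist _ (\val g *m \val h) ghu); apply/funext => i; rewrite /config_act /=.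
have [v ->] := RP_surj (p i); rewrite !RP_act_pi.
by congr (\pi_RP _); apply/val_inj; rewrite /= mulmxA.
Qed.

Canonical same_orbit_equiv :=
  EquivRel same_orbit same_orbit_refl same_orbit_sym same_orbit_trans.

Definition shapes : Type := quotient_topology {eq_quot same_orbit}.
HB.instance Definition _ := Topological.on shapes.
HB.instance Definition _ := Quotient.on shapes.

Definition shape_of (p : config) : shapes := \pi_shapes p.

Definition represents (P : 'M[R]_(k, d.+1)) (p : config) : Prop :=
  forall i, exists2 v : nzvec, \val v = row i P & p i = \pi_RP v.

Definition represents_shape (P : 'M[R]_(k, d.+1)) (x : shapes) : Prop :=
  exists2 p : config, represents P p & shape_of p = x.

(* One particular representing matrix; ranks of sets of rows do not depend on
   the choice of the homogeneous coordinates. *)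
Definition config_mx (p : config) : 'M[R]_(k, d.+1) :=
  \matrix_(i < k) \val (repr (p i)).

Definition subconfig_mx (p : config) (I : {set 'I_k}) : 'M[R]_(#|I|, d.+1) :=
  rowsub (fun i : 'I_#|I| => enum_val i) (config_mx p).

Definition rk (p : config) (I : {set 'I_k}) : nat := \rank (subconfig_mx p I).

Definition general_position (p : config) : Prop :=
  forall I : {set 'I_k}, #|I| = d.+1 -> row_free (subconfig_mx p I).

Definition full_rank (p : config) : Prop := \rank (config_mx p) = d.+1.

Definition general_shapes : set shapes :=
  shape_of @` [set p | general_position p].

Definition full_rank_shapes : set shapes :=
  shape_of @` [set p | full_rank p].

Definition constraints (p : config) : set ({set 'I_k} * nat) :=
  [set c : {set 'I_k} * nat |
    [/\ (1 <= c.2 < d.+1)%N, (c.2 <= #|c.1|)%N & (rk p c.1 <= c.2)%N]].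

End Configurations.

Arguments shape_of {R d k}.
Arguments general_shapes : clear implicits.
Arguments full_rank_shapes : clear implicits.
Arguments constraints {R d k}.
Arguments represents_shape {R d k}.

(* There are l.+1 block rows and m.+1 block columns, of sizes h r and w s; the
   indices ord0 and ord_max stand for the first and the last block. *)
Definition linked_blocks (R : realType) (l m : nat)
    (h : 'I_l.+1 -> nat) (w : 'I_m.+1 -> nat)
    (P Q : forall r s, 'M[R]_(h r, w s))
    (D : forall r, 'M[R]_(h r)) (B : forall s, 'M[R]_(w s)) : Prop :=
  [/\ (forall r, r != ord0 -> P r ord0 = 0)
        /\ (forall s, s != ord_max -> P ord_max s = 0),
      (forall s, s != ord0 -> Q ord0 s = 0)
        /\ (forall r, r != ord_max -> Q r ord_max = 0),
      Q ord0 ord0 = D ord0 *m P ord0 ord0 *m B ord0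
        /\ Q ord_max ord_max = D ord_max *m P ord_max ord_max *m B ord_max,
      (forall r s, P r s != 0 -> Q r s != 0 -> Q r s = D r *m P r s *m B s) &
      (forall r s,
         (exists (a : 'I_l.+1) (b : 'I_m.+1),
            [/\ (a, b) != (r, s), (a <= r)%N, (s <= b)%N & Q a b != 0]) ->
         P r s = 0)
        /\ (forall r s,
         (exists (a : 'I_l.+1) (b : 'I_m.+1),
            [/\ (a, b) != (r, s), (r <= a)%N, (b <= s)%N & P a b != 0]) ->
         Q r s = 0)].

(* Main.v *)
Require Import Defs.
From mathcomp Require Import all_boot all_order all_algebra all_fingroup.
From mathcomp Require Import generic_quotient.
From mathcomp Require Import all_classical all_reals all_analysis.
From mathcomp Require Import ring.

(* Since general position is dense and both quotient maps are open, two shapes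
   cannot be separated in Y if and only if representing matrices P and Q are
   limits of matrices P_n and Q_n = D_n P_n B_n.

   If so, complete pivoting writes B_n as K_n A_n L_n with A_n diagonal and
   K_n, L_n bounded together with their inverses.  Along an ultrafilter K_n and
   L_n converge, and after a change of basis Q is obtained from P by an entrywise
   limit in which the (i,j) entry is multiplied by delta_i alpha_j.  Grouping
   rows (resp. columns) of comparable growth into blocks, ordered by increasing
   delta (resp. decreasing alpha), gives the partition: a nonzero entry of P
   forces delta_i alpha_j to stay bounded, a nonzero entry of Q forces it to stay
   away from 0.

   Conversely, the staircase condition (iii) allows one to choose the growth
   rates of the blocks as powers of a parameter t -> 0.  For (A), the rows outside
   the first block row span too little in P, and those inside it in Q. *)

Set Implicit Arguments.
Unset Strict Implicit.
Unset Printing Implicit Defensive.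

Import Order.TTheory GRing.Theory Num.Theory.
Import numFieldNormedType.Exports.

Local Open Scope classical_set_scope.
Local Open Scope quotient_scope.
Local Open Scope ring_scope.

(** * Complete pivoting *)

Section Pivoting.
Variable R : realType.

Definition entries_le m n (C : R) (A : 'M[R]_(m, n)) : Prop :=
  forall i j, `|A i j| <= C.

Lemma entries_le_trans m n (C C' : R) (A : 'M[R]_(m, n)) :
  C <= C' -> entries_le C A -> entries_le C' A.
Proof. by move=> CC' AC i j; apply: le_trans CC'. Qed.

Lemma entries_le_mul m n p (C C' : R) (A : 'M[R]_(m, n)) (B : 'M[R]_(n, p)) :
  entries_le C A -> entries_le C' B -> entries_le (C * C' *+ n) (A *m B).
Proof.
move=> AC BC i j; rewrite mxE; apply: le_trans (ler_norm_sum _ _ _) _.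
apply: (@le_trans _ _ (\sum_(k < n) C * C')); last first.
  by rewrite sumr_const card_ord.
by apply: ler_sum => k _; rewrite normrM ler_pM.
Qed.

Lemma entries_le_block m1 m2 n1 n2 (C : R) (A : 'M[R]_(m1, n1))
    (B : 'M[R]_(m1, n2)) (A' : 'M[R]_(m2, n1)) (B' : 'M[R]_(m2, n2)) :
  entries_le C A -> entries_le C B -> entries_le C A' -> entries_le C B' ->
  entries_le C (block_mx A B A' B').
Proof.
by move=> hA hB hA' hB' i j; case: (split_ordP i) => i' ->;
  case: (split_ordP j) => j' ->;
  rewrite ?(block_mxEul, block_mxEur, block_mxEdl, block_mxEdr).
Qed.

Lemma entries_le_xrow m n (C : R) i1 i2 (A : 'M[R]_(m, n)) :
  entries_le C A -> entries_le C (xrow i1 i2 A).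
Proof. by move=> AC i j; rewrite mxE. Qed.

Lemma entries_le_xcol m n (C : R) j1 j2 (A : 'M[R]_(m, n)) :
  entries_le C A -> entries_le C (xcol j1 j2 A).
Proof. by move=> AC i j; rewrite mxE. Qed.

Lemma entries_le1 n (C : R) : 1 <= C -> entries_le C (1%:M : 'M[R]_n).
Proof.
move=> C1 i j; rewrite mxE; apply: le_trans C1.
by case: eqP => _ /=; rewrite ?normr1 ?normr0.
Qed.

(* Gaussian elimination with complete pivoting only uses multipliers of absolute
   value at most 1, so the two outer factors range over a bounded set. *)
Lemma bounded_diagonalization n : exists2 C : R, 1 <= C &
  forall A : 'M[R]_n, exists (K K' L L' : 'M[R]_n) (a : 'rV[R]_n),
    [/\ K *m K' = 1%:M, L *m L' = 1%:M, A = K *m diag_mx a *m L,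
        entries_le C K /\ entries_le C K' & entries_le C L /\ entries_le C L'].
Proof.
elim: n => [|n [C C1 IHn]].
  exists 1 => // A; exists 0, 0, 0, 0, 0.
  by split; [apply/matrixP=> -[] | apply/matrixP=> -[] | apply/matrixP=> -[]
    | split=> -[] | split=> -[]].
have C0 : 0 <= C by apply: le_trans C1.
have le1 : 1 <= 1 + C *+ n.+1 by rewrite lerDl mulrn_wge0.
have leC : C <= 1 + C *+ n.+1.
  by rewrite mulrS addrCA lerDl addr_ge0 ?mulrn_wge0.
(* Besides 1 and [C], this constant dominates [C *+ n], which bounds the products [K' *m v] and
   [u *m L'] occurring in the inverses. *)
exists (1 + C *+ n.+1) => // A.
have [->|A0] := eqVneq A 0.
  exists 1%:M, 1%:M, 1%:M, 1%:M, 0.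
  by split; rewrite ?mul1mx //; [rewrite raddf0 mul0mx | split; apply: entries_le1
    | split; apply: entries_le1].
have [i0 [j0 max_ij]] : exists i0 j0, forall i j, `|A i j| <= `|A i0 j0|.
  pose f (p : 'I_n.+1 * 'I_n.+1) := `|A p.1 p.2|.
  have [[i0 j0] _ maxp] :=
    (Order.TotalTheory.arg_maxP f (i0 := (ord0, ord0)) (P := predT) isT).
  by exists i0, j0 => i j; apply: (maxp (i, j)).
pose A1 : 'M[R]_(1 + n) := xrow i0 0 (xcol j0 0 A).
have A1E : A = xrow i0 0 (xcol j0 0 A1).
  by apply/matrixP => i j; rewrite !mxE !tpermK.
have maxA1 i j : `|A1 i j| <= `|A1 0 0| by rewrite !mxE !tpermR max_ij.
have A100 : A1 0 0 != 0.
  apply: contraNneq A0 => A100; apply/eqP/matrixP => i j.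
  rewrite [RHS]mxE; apply/eqP; rewrite -normr_le0 (le_trans (max_ij i j)) //.
  by move: A100; rewrite !mxE !tpermR => ->; rewrite normr0.
set c := A1 0 0 in maxA1 A100.
(* The pivot [c] has the largest absolute value, so the multipliers in [u] and [v] are at most 1 in
   absolute value. The induction continues on the Schur complement. *)
pose u : 'rV[R]_n := c^-1 *: ursubmx A1; pose v : 'cV[R]_n := c^-1 *: dlsubmx A1.
have u1 : entries_le 1 u.
  move=> i j; rewrite !mxE normrM normfV mulrC ler_pdivrMr ?normr_gt0 // mul1r.
  by have := maxA1 (lshift n i) (rshift 1 j); rewrite !mxE.
have v1 : entries_le 1 v.
  move=> i j; rewrite !mxE normrM normfV mulrC ler_pdivrMr ?normr_gt0 // mul1r.
  by have := maxA1 (rshift 1 i) (lshift n j); rewrite !mxE.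
have [K [K' [L [L' [a [KK LL W [bK bK'] [bL bL']]]]]]] :=
  IHn (drsubmx A1 - c *: (v *m u)).
pose K1 : 'M[R]_(1 + n) := block_mx 1%:M 0 v K.
pose K1' : 'M[R]_(1 + n) := block_mx 1%:M 0 (- (K' *m v)) K'.
pose L1 : 'M[R]_(1 + n) := block_mx 1%:M u 0 L.
pose L1' : 'M[R]_(1 + n) := block_mx 1%:M (- (u *m L')) 0 L'.
pose a1 : 'rV[R]_(1 + n) := row_mx c%:M a.
have KK1 : K1 *m K1' = 1%:M.
  rewrite mulmx_block !mul1mx !mul0mx !mulmx0 !mulmx1 !addr0 !add0r mulmxN mulmxA.
  by rewrite KK mul1mx subrr -scalar_mx_block.
have LL1 : L1 *m L1' = 1%:M.
  rewrite mulmx_block !mul1mx !mul0mx !mulmx0 !addr0 ?add0r addNr LL.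
  by rewrite -scalar_mx_block.
have A1f : A1 = K1 *m diag_mx a1 *m L1.
  rewrite -[A1 in LHS](@submxK _ 1 n 1 n) diag_mx_row /K1 /L1 !mulmx_block.
  rewrite !(mul1mx, mul0mx, mulmx0, mulmx1, addr0, add0r) -W.
  have -> : diag_mx (c%:M : 'M[R]_1) = c%:M.
    by apply/matrixP => i j; rewrite !ord1 !mxE.
  rewrite mul_mx_scalar !mul_scalar_mx -scalemxAl addrC subrK /u /v !scalerA divff //.
  rewrite !scale1r; congr block_mx; rewrite [LHS]mx11_scalar; congr _%:M.
  by rewrite /c !mxE /= !lshift0.
have invx i : (xrow i 0 1%:M : 'M[R]_n.+1) *m xrow i 0 1%:M = 1%:M.
  by rewrite !xrowE !mulmx1 -perm_mxM tperm2 perm_mx1.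
have xrow1 i (M : 'M[R]_n.+1) : xrow i 0 M = xrow i 0 1%:M *m M.
  by rewrite !xrowE mulmx1.
have xcol1 i (M : 'M[R]_n.+1) : xcol i 0 M = M *m xrow i 0 1%:M.
  by rewrite xcolE xrowE mulmx1.
have nC : C *+ n <= 1 + C *+ n.+1 by rewrite mulrS addrA lerDr addr_ge0.
exists (xrow i0 0 K1), (xcol i0 0 K1'), (xcol j0 0 L1), (xrow j0 0 L1'), a1; split.
- rewrite xrow1 (xcol1 _ K1') mulmxA -(mulmxA (xrow _ _ _)) KK1 mulmx1; exact: invx.
- rewrite xcol1 (xrow1 _ L1') mulmxA -(mulmxA L1) invx mulmx1; exact: LL1.
- by rewrite {1}A1E A1f xcol1 xrow1 (xrow1 _ K1) (xcol1 _ L1) !mulmxA.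
- split; [apply: entries_le_xrow | apply: entries_le_xcol]; apply: (@entries_le_block 1 n 1 n).
  + exact: entries_le1.
  + by move=> i j; rewrite mxE normr0 (le_trans ler01).
  + exact: entries_le_trans v1.
  + exact: entries_le_trans bK.
  + exact: entries_le1.
  + by move=> i j; rewrite mxE normr0 (le_trans ler01).
  + apply: (entries_le_trans nC) => i j; rewrite mxE normrN.
    by have := entries_le_mul bK' v1 i j; rewrite mulr1.
  + exact: entries_le_trans bK'.
split; [apply: entries_le_xcol | apply: entries_le_xrow]; apply: (@entries_le_block 1 n 1 n).
+ exact: entries_le1.
+ exact: entries_le_trans u1.
+ by move=> i j; rewrite mxE normr0 (le_trans ler01).
+ exact: entries_le_trans bL.
+ exact: entries_le1.
+ apply: (entries_le_trans nC) => i j; rewrite mxE normrN.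
  by have := entries_le_mul u1 bL' i j; rewrite mul1r.
+ by move=> i j; rewrite mxE normr0 (le_trans ler01).
+ exact: entries_le_trans bL'.
Qed.

End Pivoting.

(** * Limits along an ultrafilter *)

(** Matrix form of inseparability: arbitrarily near [P] and [Q] there are matrices that differ by a
    row scaling and a change of basis. If their rows are non-zero, they represent one common
    shape. *)
Definition linkable (R : realType) m n (P Q : 'M[R]_(m, n)) : Prop :=
  forall e : R, 0 < e -> exists (P' Q' : 'M[R]_(m, n)) (delta : 'rV[R]_m) (B : 'M[R]_n),
    [/\ forall i, delta 0 i != 0, B \in unitmx, Q' = diag_mx delta *m P' *m B,
        forall i j, `|P' i j - P i j| < e & forall i j, `|Q' i j - Q i j| < e].

Section UltrafilterLimits.
Variables (R : realType) (F : set_system nat).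
Context {FU : UltraFilter F}.
Implicit Types f g : nat -> R.

Definition ubounded f : Prop := exists M : R, \forall n \near F, `|f n| <= M.

(** The image of [F] contains a compact interval, hence has a cluster point. For an ultrafilter a
    cluster point is a limit: a neighbourhood not in the filter would have its complement there. *)
Lemma ubounded_cvg f : ubounded f -> exists c : R, f n @[n --> F] --> c.
Proof.
move=> [M fM].
have FfM : (f @ F) [set` `[- M, M]].
  by apply: filterS fM => n; rewrite /= in_itv /= -ler_norml.
have [c [_ clc]] := @segment_compact R (- M) M (f @ F) _ FfM.
exists c => B cB.
have [//|FnB] := in_ultra_setVsetC (f @^-1` B) FU.
have : (f @ F) (~` B) by [].
by move=> /clc /(_ cB)[x []].
Qed.

Lemma cvg_ubounded f (c : R) : f n @[n --> F] --> c -> ubounded f.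
Proof.
move=> fc; exists (`|c| + 1).
have /cvgrPdist_le /(_ 1 ltr01) := fc.
apply: filterS => n cfn; rewrite -(subrK c (f n)) (le_trans (ler_normD _ _)) //.
by rewrite addrC lerD // distrC.
Qed.

Lemma uboundedM f g : ubounded f -> ubounded g -> ubounded (fun n => f n * g n).
Proof.
move=> [M fM] [N gN]; exists (M * N); near=> n; rewrite normrM ler_pM //.
  by near: n.
by near: n.
Unshelve. all: by end_near. Qed.

(** The ultrafilter decides whether $|f|\le 1$; if not, the inverse is bounded by 1. This dichotomy
    makes the comparison of growth rates total. *)
Lemma ubounded_total f : ubounded f \/ ubounded (fun n => (f n)^-1).
Proof.
have [f1|f1] := in_ultra_setVsetC [set n | `|f n| <= 1] FU; [left|right]; exists 1.
  exact: f1.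
apply: filterS f1 => n /= /negP; rewrite -ltNge => f1.
by rewrite normfV invf_le1 ?(lt_trans ltr01) // ltW.
Qed.

Lemma ulim_unique f (c c' : R) :
  f n @[n --> F] --> c -> f n @[n --> F] --> c' -> c = c'.
Proof. by move=> fc fc'; exact: (norm_cvg_unique fc fc'). Qed.

(** The inverses converge too, and the product of the two limits is 1. *)
Lemma cvg_neq0 f (c : R) : (forall n, f n != 0) ->
  f n @[n --> F] --> c -> ubounded (fun n => (f n)^-1) -> c != 0.
Proof.
move=> f0 fc /ubounded_cvg[c' fc'].
have ff1 : f n * (f n)^-1 @[n --> F] --> c * c' by exact: cvgM fc fc'.
have ff_cst : (fun n => f n * (f n)^-1) = fun=> 1.
  by apply/funext => n; rewrite divff.
have cc1 : c * c' = 1.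
  by apply: ulim_unique ff1 _; rewrite ff_cst; exact: cvg_cst.
by apply: contra_eq_neq cc1 => ->; rewrite mul0r eq_sym oner_neq0.
Qed.
End UltrafilterLimits.

(** * Ranking a finite total preorder *)

(** Each element is measured by the number of elements strictly below it; the position in the sorted
    list of attained values then numbers the classes without gaps. The element [x0] guarantees a
    first class. *)
Lemma preorder_ranking (T : finType) (x0 : T) (e : rel T) :
  total e -> transitive e ->
  exists m (f : T -> 'I_m.+1),
    (forall x y, (f x <= f y)%N = e x y) /\ forall r, exists x, f x = r.
Proof.
move=> e_total e_trans.
pose below x := #|[pred z | ~~ e x z]|.
have e_refl x : e x x by have := e_total x x; rewrite orbb.
have belowE x y : (below x <= below y)%N = e x y.
  have le a b : e a b -> (below a <= below b)%N.
    move=> ab; apply/subset_leq_card/fintype.subsetP => z; rewrite !inE.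
    by apply: contra => /(e_trans _ _ _ ab).
  apply/idP/idP; last exact: le.
  apply: contraTT => nxy; rewrite -ltnNge.
  have yx : e y x by have := e_total x y; rewrite (negPf nxy).
  apply/proper_card/fintype.properP; split; last by exists y; rewrite !inE ?nxy ?e_refl.
  apply/fintype.subsetP => z; rewrite !inE; by apply: contra => /(e_trans _ _ _ yx).
pose s := sort leq (undup [seq below x | x <- enum T]).
have s_sorted : sorted leq s by apply: sort_sorted; exact: leq_total.
have s_uniq : uniq s by rewrite sort_uniq undup_uniq.
have mem_s x : below x \in s.
  by rewrite mem_sort mem_undup map_f // mem_enum.
have s_size : (size s).-1.+1 = size s.
  by rewrite prednK // -has_predT; apply/hasP; exists (below x0).
have lt_s x : (index (below x) s < (size s).-1.+1)%N.
  by rewrite s_size index_mem.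
exists (size s).-1, (fun x => Ordinal (lt_s x)); split => [x y /=|[r ltr]].
  rewrite -belowE.
  apply/idP/idP.
    move=> h; rewrite -[below x](nth_index 0%N (mem_s x)).
    rewrite -[below y](nth_index 0%N (mem_s y)).
    apply: (sorted_leq_nth leq_trans leqnn) => //; by rewrite inE index_mem.
  apply: contraTT; rewrite -!ltnNge => h.
  have s_lt : sorted ltn s by rewrite ltn_sorted_uniq_leq s_uniq.
  rewrite -[below x](nth_index 0%N (mem_s x)) -[below y](nth_index 0%N (mem_s y)).
  by apply: (sorted_ltn_nth ltn_trans) => //; rewrite inE index_mem.
have rs : (r < size s)%N by rewrite -s_size.
have : nth 0%N s r \in s by rewrite mem_nth.
rewrite mem_sort mem_undup => /mapP[x _ rx].
by exists x; apply: val_inj; rewrite /= -rx index_uniq.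
Qed.

(** * Entrywise limits of matrices and growth rates *)

Definition mx_cvg (R : realType) (T : Type) (F : set_system T) m n
    (A_ : T -> 'M[R]_(m, n)) (A : 'M[R]_(m, n)) : Prop :=
  forall i j, A_ k i j @[k --> F] --> A i j.

Lemma mx_cvg_mul (R : realType) (T : Type) (F : set_system T) {FF : ProperFilter F}
    m n p (A_ : T -> 'M[R]_(m, n)) A (B_ : T -> 'M[R]_(n, p)) B :
  mx_cvg F A_ A -> mx_cvg F B_ B -> mx_cvg F (fun k => A_ k *m B_ k) (A *m B).
Proof.
move=> cA cB i j; rewrite mxE; under eq_cvg do rewrite mxE.
by apply: cvg_big => [|l _]; [exact: add_continuous | exact: cvgM].
Qed.

Arguments mx_cvg_mul {R T F FF m n p A_ A B_ B} _ _ i j _ _.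

(** Bounded entries converge along an ultrafilter, for the matrices and for their inverses; the
    identity $A_kA'_k=1$ passes to the limit, so the limit is non-singular. *)
Lemma mx_cvg_unit (R : realType) (F : set_system nat) {FU : UltraFilter F} n
    (A_ A'_ : nat -> 'M[R]_n) (C : R) :
  (forall k, A_ k *m A'_ k = 1%:M) ->
  (forall k, entries_le C (A_ k) /\ entries_le C (A'_ k)) ->
  exists A, [/\ A \in unitmx, mx_cvg F A_ A & mx_cvg F A'_ (invmx A)].
Proof.
move=> AA' bA.
have lim_ex (M_ : nat -> 'M[R]_n) : (forall k, entries_le C (M_ k)) ->
    exists M : 'M[R]_n, mx_cvg F M_ M.
  move=> bM.
  have /choice[f cf] : forall ij : 'I_n * 'I_n, exists c : R,
      M_ k ij.1 ij.2 @[k --> F] --> c.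
    by move=> ij; apply: ubounded_cvg; exists C; near=> k; exact: bM.
  by exists (\matrix_(i, j) f (i, j)) => i j; rewrite mxE; exact: (cf (i, j)).
have [A cA] := lim_ex A_ (fun k => (bA k).1).
have [A' cA'] := lim_ex A'_ (fun k => (bA k).2).
have AA'1 : A *m A' = 1%:M.
  apply/matrixP => i j; apply: (ulim_unique (mx_cvg_mul cA cA' i j)).
  by under eq_cvg do rewrite AA'; exact: cvg_cst.
have [uA uA'] := mulmx1_unit AA'1.
exists A; split=> //.
by rewrite (_ : invmx A = A') // -[LHS]mulmx1 -AA'1 mulKmx.
Unshelve. all: by end_near. Qed.

(** What remains in the limit of the relation
    $Q_k=\mathrm{diag}(\delta)\,P_k\,\mathrm{diag}(\alpha)$, in which the entry $(i,j)$ is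
    multiplied by $\delta_i\alpha_j$: a non-zero limit in [P] bounds this rate from above, one in
    [Q] bounds it away from 0. *)
Definition rates_for (R : realType) (F : set_system nat) m n
    (delta : 'I_m -> nat -> R) (alpha : 'I_n -> nat -> R)
    (P Q : 'M[R]_(m, n)) : Prop :=
  [/\ forall i k, delta i k != 0, forall j k, alpha j k != 0,
      forall i j, P i j != 0 -> ubounded F (fun k => delta i k * alpha j k),
      forall i j, Q i j != 0 -> ubounded F (fun k => (delta i k * alpha j k)^-1) &
      forall i j (c : R), delta i k * alpha j k @[k --> F] --> c -> Q i j = c * P i j].

(** With $B_k=K_kA_kL_k$ and $A_k$ diagonal, $Q_kL_k^{-1}$ is a row and column rescaling of
    $P_kK_k$. The outer factors converge along an ultrafilter because they and their inverses are
    uniformly bounded. *)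
Lemma linkable_rates (R : realType) m n (P Q : 'M[R]_(m, n)) :
  linkable P Q ->
  exists (F : set_system nat) (K L : 'M[R]_n)
         (delta : 'I_m -> nat -> R) (alpha : 'I_n -> nat -> R),
    [/\ UltraFilter F, K \in unitmx, L \in unitmx &
        rates_for F delta alpha (P *m K) (Q *m L)].
Proof.
move=> PQ; have [C _ diagC] := bounded_diagonalization R n.
have /choice[x xP] : forall k : nat, exists x : 'M[R]_(m, n) * 'M[R]_(m, n) *
    'rV[R]_m * ('M[R]_n * 'M[R]_n * 'M[R]_n * 'M[R]_n * 'rV[R]_n),
    let: (P', Q', dl, (K, K', L, L', a)) := x in
    [/\ (forall i, dl 0 i != 0) /\ (forall i, a 0 i != 0),
        Q' *m L' = diag_mx dl *m (P' *m K) *m diag_mx a,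
        (forall i j, `|P' i j - P i j| < k.+1%:R^-1) /\
        (forall i j, `|Q' i j - Q i j| < k.+1%:R^-1),
        [/\ K *m K' = 1%:M, entries_le C K & entries_le C K'] &
        [/\ L' *m L = 1%:M, entries_le C L' & entries_le C L]].
  move=> k; have k0 : (0 : R) < k.+1%:R^-1 by rewrite invr_gt0 ltr0n.
  have [P' [Q' [dl [B [dl0 uB QE closeP closeQ]]]]] := PQ _ k0.
  have [K [K' [L [L' [a [KK LL BE [bK bK'] [bL bL']]]]]]] := diagC B.
  exists (P', Q', dl, (K, K', L, L', a)); split=> //.
  - split=> // i; apply: contraTneq uB => ai0.
    rewrite BE !unitmx_mul negb_and negb_and; apply/orP; left; apply/orP; right.
    rewrite unitmxE det_diag unitfE negbK; apply/prodf_eq0.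
    by exists i => //; rewrite ai0.
  - by rewrite QE BE !mulmxA -(mulmxA _ L L') LL mulmx1.
  - by split=> //; exact: mulmx1C.
(* The ultrafilter refines the eventual filter, so the errors $1/(k+1)$ still tend to 0 along it. *)
have [F [FU subF]] := ultraFilterLemma eventually_filter.
pose P_ k := (x k).1.1.1; pose Q_ k := (x k).1.1.2; pose dl k := (x k).1.2.
pose K_ k := (x k).2.1.1.1.1; pose K'_ k := (x k).2.1.1.1.2.
pose L_ k := (x k).2.1.1.2; pose L'_ k := (x k).2.1.2; pose a k := (x k).2.2.
have {xP} xP k :
    [/\ (forall i, dl k 0 i != 0) /\ (forall i, a k 0 i != 0),
        Q_ k *m L'_ k = diag_mx (dl k) *m (P_ k *m K_ k) *m diag_mx (a k),
        (forall i j, `|P_ k i j - P i j| < k.+1%:R^-1) /\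
        (forall i j, `|Q_ k i j - Q i j| < k.+1%:R^-1),
        [/\ K_ k *m K'_ k = 1%:M, entries_le C (K_ k) & entries_le C (K'_ k)] &
        [/\ L'_ k *m L_ k = 1%:M, entries_le C (L'_ k) & entries_le C (L_ k)]].
  move: (xP k); rewrite /P_ /Q_ /dl /K_ /K'_ /L_ /L'_ /a.
  by case: (x k) => [[[? ?] ?] [[[[? ?] ?] ?] ?]].
have close_cvg (A_ : nat -> 'M[R]_(m, n)) (A : 'M[R]_(m, n)) :
    (forall k i j, `|A_ k i j - A i j| < k.+1%:R^-1) -> mx_cvg F A_ A.
  move=> cA i j; apply/cvgrPdist_lt => e e0; apply: subF.
  near=> k; rewrite distrC (lt_trans (cA _ _ _)) //.
  by near: k; exact: (near_infty_natSinv_lt (PosNum e0)).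
have cP : mx_cvg F P_ P by apply: close_cvg => k; have [_ _ []] := xP k.
have cQ : mx_cvg F Q_ Q by apply: close_cvg => k; have [_ _ []] := xP k.
have [K [uK cK _]] : exists K, [/\ K \in unitmx, mx_cvg F K_ K & mx_cvg F K'_ (invmx K)].
  by apply: (@mx_cvg_unit _ _ _ _ _ _ C) => k; have [_ _ _ []] := xP k.
have [L [uL cL _]] : exists L, [/\ L \in unitmx, mx_cvg F L'_ L & mx_cvg F L_ (invmx L)].
  by apply: (@mx_cvg_unit _ _ _ _ _ _ C) => k; have [_ _ _ _ []] := xP k.
have cPK : mx_cvg F (fun k => P_ k *m K_ k) (P *m K) by exact: mx_cvg_mul.
have cQL : mx_cvg F (fun k => Q_ k *m L'_ k) (Q *m L) by exact: mx_cvg_mul.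
(* Here [L] is the limit of the inverse factors [L'_ k], as it is [Q_ k *m L'_ k] that is a
   rescaling of [P_ k *m K_ k]. *)
exists F, K, L, (fun i k => dl k 0 i), (fun j k => a k 0 j); split=> //.
have QLE k i j : (Q_ k *m L'_ k) i j = dl k 0 i * a k 0 j * (P_ k *m K_ k) i j.
  have [_ -> _ _ _] := xP k.
  by rewrite mul_mx_diag mxE mul_diag_mx mxE mulrAC.
have dl0 i k : dl k 0 i != 0 by have [[]] := xP k.
have a0 j k : a k 0 j != 0 by have [[]] := xP k.
(* A rate, or its inverse, is a quotient of corresponding entries of the two sequences; it is
   bounded as soon as the denominator has a non-zero limit. *)
have ubd f g (c d : R) : f n @[n --> F] --> c -> g n @[n --> F] --> d ->
    c != 0 -> ubounded F (fun n => g n / f n).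
  move=> fc gd c0; apply: (@cvg_ubounded _ _ _ _ (d / c)).
  by apply: cvgM => //; exact: cvgV.
have near_neq0 f (c : R) : f n @[n --> F] --> c -> c != 0 -> \forall n \near F, f n != 0.
  move=> fc c0; exact: (cvgr_neq0 _ fc).
split=> // [i j PKij|i j QLij|i j c cdl].
- have [M bM] := ubd _ _ _ _ (cPK i j) (cQL i j) PKij.
  exists M; near=> k.
  have PKk : (P_ k *m K_ k) i j != 0 by near: k; exact: near_neq0 (cPK i j) PKij.
  rewrite -[X in `|X|](mulfK PKk) -QLE; near: k; exact: bM.
- have [M bM] := ubd _ _ _ _ (cQL i j) (cPK i j) QLij.
  exists M; near=> k.
  have := near (near_neq0 _ _ (cQL i j) QLij) k; rewrite QLE mulf_eq0 negb_or.
  move=> /(_ _)/andP[//|_ PKk].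
  have -> : (dl k 0 i * a k 0 j)^-1 = (P_ k *m K_ k) i j / (Q_ k *m L'_ k) i j.
    by rewrite QLE [in RHS]invfM mulrCA divff // mulr1.
  near: k; exact: bM.
- apply: (ulim_unique (cQL i j)); under eq_cvg do rewrite QLE.
  exact: cvgM.
Unshelve. all: by end_near. Qed.

(* rho and gamma send a row and a column to the index of their block; the last
   two conditions are (iii)-(iv) and (ii) read off entry by entry. *)
Definition linked_entries (R : realType) m n l c (P Q : 'M[R]_(m, n))
    (rho : 'I_m -> 'I_l.+1) (gamma : 'I_n -> 'I_c.+1)
    (d : 'I_m -> R) (b : 'I_n -> R) : Prop :=
  [/\ (forall r, exists i, rho i = r) /\ (forall s, exists j, gamma j = s),
      (forall i, d i != 0) /\ (forall j, b j != 0),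
      forall i j i' j', (rho i <= rho i')%N -> (gamma j' <= gamma j)%N ->
        Q i j != 0 -> P i' j' != 0 -> rho i = rho i' /\ gamma j = gamma j' &
      forall i j i1 j1 i2 j2, rho i1 = rho i -> gamma j1 = gamma j ->
        rho i2 = rho i -> gamma j2 = gamma j ->
        P i1 j1 != 0 -> Q i2 j2 != 0 -> Q i j = d i * P i j * b j].

(** Two rows, or two columns, share a block when the ratio of their scalings is bounded in both
    directions. Boundedness of the rates at two entries can then be compared by multiplying ratios,
    which yields the staircase condition. *)
Lemma rates_linked (R : realType) (F : set_system nat) {FU : UltraFilter F} m n
    (delta : 'I_m -> nat -> R) (alpha : 'I_n -> nat -> R) (P Q : 'M[R]_(m, n)) :
  'I_m -> 'I_n -> rates_for F delta alpha P Q ->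
  exists l c (rho : 'I_m -> 'I_l.+1) (gamma : 'I_n -> 'I_c.+1)
    (d : 'I_m -> R) (b : 'I_n -> R), linked_entries P Q rho gamma d b.
Proof.
move=> i0 j0 [d0 a0 hP hQ hPQ].
have ub_ext f g : f =1 g -> ubounded F f -> ubounded F g.
  by move=> /funext ->.
have ranking p (p0 : 'I_p) (x : 'I_p -> nat -> R) : (forall i k, x i k != 0) ->
    exists l (rho : 'I_p -> 'I_l.+1),
      (forall i i', (rho i <= rho i')%N <-> ubounded F (fun k => x i k / x i' k)) /\
      forall r, exists i, rho i = r.
  move=> x0; pose e i i' := `[< ubounded F (fun k => x i k / x i' k) >].
  have e_total : total e.
    move=> i i'; apply/orP.
    have [h|h] := @ubounded_total _ _ FU (fun k => x i k / x i' k); [left|right].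
      exact/asboolP.
    by apply/asboolP; apply: ub_ext h => k; rewrite invfM invrK mulrC.
  have e_trans : transitive e.
    move=> i2 i1 i3 /asboolP h12 /asboolP h23; apply/asboolP.
    by apply: ub_ext (uboundedM h12 h23) => k; rewrite mulrA divfK.
  have [l [rho [rhoE rho_surj]]] := preorder_ranking p0 e_total e_trans.
  exists l, rho; split=> // i i'; rewrite rhoE; split=> [/asboolP//|h].
  exact/asboolP.
have [l [rho [rhoE rho_surj]]] := ranking _ i0 _ d0.
(* Columns are ranked by the inverses of [alpha], so a larger block index means slower growth. *)
have [c [gamma [gammaE gamma_surj]]] : exists c (gamma : 'I_n -> 'I_c.+1),
      (forall j j', (gamma j <= gamma j')%N <->
                    ubounded F (fun k => alpha j' k / alpha j k)) /\
      forall s, exists j, gamma j = s.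
  have [|c [gamma [gammaE gamma_surj]]] := ranking _ j0 (fun j k => (alpha j k)^-1).
    by move=> j k; rewrite invr_neq0.
  exists c, gamma; split=> // j j'; rewrite gammaE.
  by split; apply: ub_ext => k; rewrite invrK mulrC.
have same_row i i' : rho i = rho i' -> ubounded F (fun k => delta i k / delta i' k).
  by move=> ii'; apply/rhoE; rewrite ii'.
have same_col j j' : gamma j = gamma j' -> ubounded F (fun k => alpha j k / alpha j' k).
  by move=> jj'; apply/gammaE; rewrite jj'.
have staircase i j i' j' : (rho i <= rho i')%N -> (gamma j' <= gamma j)%N ->
    ubounded F (fun k => (delta i k * alpha j k)^-1) ->
    ubounded F (fun k => delta i' k * alpha j' k) ->
    rho i = rho i' /\ gamma j = gamma j'.
  move=> ii' jj' uij uij'; split; apply/val_inj/anti_leq; rewrite /= ?ii' ?jj' ?andbT.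
    apply/rhoE; move: jj' => /gammaE jj'.
    apply: ub_ext (uboundedM (uboundedM uij uij') jj') => k.
    by rewrite -?(mulrA, invfM); field; rewrite ?d0 ?a0.
  apply/gammaE; move: ii' => /rhoE ii'.
  apply: ub_ext (uboundedM (uboundedM uij uij') ii') => k.
  by field; rewrite ?d0 ?a0.
have [rep repE] : exists rep : 'I_c.+1 -> 'I_n, forall s, gamma (rep s) = s.
  by have [f fP] := choice gamma_surj; exists f.
(* The rate of row [i] in block column [s], measured at the representative column, stays bounded and
   away from 0. *)
pose tight i s := ubounded F (fun k => delta i k * alpha (rep s) k) /\
  ubounded F (fun k => (delta i k * alpha (rep s) k)^-1).
(* By [staircase] a row is tight for at most one block column, so the limit depends on [i] alone. A
   row without a tight block column gets the default 1. *)
have [d dP] : exists d : 'I_m -> R, forall i, d i != 0 /\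
    forall s, tight i s -> delta i k * alpha (rep s) k @[k --> F] --> d i.
  suff /choice[d dP] : forall i, exists di : R, di != 0 /\
    forall s, tight i s -> delta i k * alpha (rep s) k @[k --> F] --> di by exists d.
  move=> i; have [[s ts]|nt] := pselect (exists s, tight i s); last first.
    by exists 1; rewrite oner_neq0; split=> // s ts; case: nt; exists s.
  have [di cdi] := ubounded_cvg ts.1.
  exists di; split.
    by apply: cvg_neq0 cdi ts.2 => k; rewrite mulf_neq0.
  move=> s' ts'; suff -> : s' = s by [].
  case/orP: (leq_total s s') => ss'.
    have := @staircase i (rep s') i (rep s) (leqnn _).
    by rewrite !repE => /(_ ss' ts'.2 ts.1)[].
  have := @staircase i (rep s) i (rep s') (leqnn _).
  by rewrite !repE => /(_ ss' ts.2 ts'.1)[].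
(* The multiplier of a column is its limiting ratio to the representative of its block; in a tight
   block the rate therefore converges to [d i * b j]. *)
have [b bP] : exists b : 'I_n -> R, forall j, b j != 0 /\
    alpha j k / alpha (rep (gamma j)) k @[k --> F] --> b j.
  suff /choice[b bP] : forall j, exists bj : R, bj != 0 /\
    alpha j k / alpha (rep (gamma j)) k @[k --> F] --> bj by exists b.
  move=> j; have [bj cbj] := ubounded_cvg (same_col _ _ (esym (repE (gamma j)))).
  exists bj; split=> //; apply: cvg_neq0 cbj _ => [k|].
    by rewrite mulf_neq0 // invr_neq0.
  apply: ub_ext (same_col _ _ (repE (gamma j))) => k.
  by rewrite invfM invrK mulrC.
exists l, c, rho, gamma, d, b; split=> //.
- by split=> [i|j]; [have [] := dP i | have [] := bP j].
- move=> i j i' j' ii' jj' Qij Pij; apply: staircase => //; [exact: hQ | exact: hP].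
move=> i j i1 j1 i2 j2 ri1 gj1 ri2 gj2 Pij Qij.
have ti : tight i (gamma j).
  have [e1 e2] : gamma (rep (gamma j)) = gamma j1 /\ gamma j2 = gamma (rep (gamma j)).
    by rewrite repE gj1 gj2.
  split.
    apply: ub_ext (uboundedM (hP _ _ Pij)
      (uboundedM (same_row _ _ (esym ri1)) (same_col _ _ e1))) => k.
    by field; rewrite ?d0 ?a0.
  apply: ub_ext (uboundedM (hQ _ _ Qij)
    (uboundedM (same_row _ _ ri2) (same_col _ _ e2))) => k.
  by field; rewrite ?d0 ?a0.
rewrite mulrAC; apply: hPQ; have [_ /(_ _ ti) cd] := dP i; have [_ cb] := bP j.
have -> : (fun k => delta i k * alpha j k) =
  (fun k => delta i k * alpha (rep (gamma j)) k * (alpha j k / alpha (rep (gamma j)) k)).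
  by apply/funext => k; field; rewrite ?a0.
exact: cvgM.
Qed.

(** * Block form *)

(** The permutation lists the fibres of [f] one after another, so that a labelling by blocks becomes
    a partition into consecutive intervals of sizes [h r]. *)
Lemma class_reindex k n (f : 'I_k -> 'I_n) : (forall r, exists i, f i = r) ->
  exists (h : 'I_n -> nat) (hk : (\sum_r h r)%N = k) (sigma : 'S_k),
    (forall r, 0 < h r)%N /\
    forall t : 'I_(\sum_r h r)%N, f (sigma (cast_ord hk t)) = tagnat.sig1 t.
Proof.
move=> f_surj; pose h r := #|[pred i | f i == r]|.
have hk : (\sum_r h r)%N = k.
  rewrite -[RHS]card_ord -sum1_card (partition_big f predT) //=.
  by apply: eq_bigr => r _; rewrite /h -sum1_card; apply: eq_bigl => i; rewrite !inE.
pose g u : 'I_k := enum_val (tagnat.sig2 (cast_ord (esym hk) u)).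
have fg u : f (g u) = tagnat.sig1 (cast_ord (esym hk) u).
  exact/eqP/(enum_valP (tagnat.sig2 (cast_ord (esym hk) u))).
have val_inj2 (p q : {r & 'I_(h r)}) :
    enum_val (tagged p) = enum_val (tagged q) :> 'I_k -> p = q.
  case: p q => [r x] [r' y] /= xy.
  have rr' : r = r'.
    by rewrite -(eqP (enum_valP x)) -(eqP (enum_valP y)) xy.
  by case: _ / rr' y xy => y /enum_val_inj ->.
have g_inj : injective g.
  by move=> u v /val_inj2/tagnat.sig_inj/cast_ord_inj.
exists h, hk, (perm g_inj); split=> [r|t]; last by rewrite permE fg cast_ordK.
by have [i fi] := f_surj r; apply/card_gt0P; exists i; rewrite inE fi.
Qed.

(** * Consequences of the staircase condition *)

Section LinkedEntries.
Variables (R : realType) (m n l c : nat) (P Q : 'M[R]_(m, n)).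
Variables (rho : 'I_m -> 'I_l.+1) (gamma : 'I_n -> 'I_c.+1).
Variables (d : 'I_m -> R) (b : 'I_n -> R).
Hypothesis PQ : linked_entries P Q rho gamma d b.
Hypotheses (rowP : forall i, exists j, P i j != 0)
  (rowQ : forall i, exists j, Q i j != 0).
Hypotheses (colP : forall j, exists i, P i j != 0)
  (colQ : forall j, exists i, Q i j != 0).

Let rho_surj r : exists i, rho i = r. Proof. by case: PQ => -[]. Qed.
Let gamma_surj s : exists j, gamma j = s. Proof. by case: PQ => -[]. Qed.

Let staircase i j i' j' : (rho i <= rho i')%N -> (gamma j' <= gamma j)%N ->
  Q i j != 0 -> P i' j' != 0 -> rho i = rho i' /\ gamma j = gamma j'.
Proof. by case: PQ => _ _ + _; apply. Qed.

(** Some row of the first block row has a non-zero entry of [Q], and this entry is weakly above and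
    to the right of every entry in the first block column; the staircase condition then excludes
    non-zero entries of [P] below the corner block. The next three lemmas are its mirror images. *)
Lemma linked_first_col i j : gamma j = ord0 -> rho i != ord0 -> P i j = 0.
Proof.
move=> j0; apply: contraNeq => Pij; have [i' i'0] := rho_surj ord0.
have [j' Qij'] := rowQ i'.
have [] := @staircase i' j' i j; rewrite ?i'0 ?j0 //.
by move=> ->.
Qed.

Lemma linked_first_row i j : rho i = ord0 -> gamma j != ord0 -> Q i j = 0.
Proof.
move=> i0; apply: contraNeq => Qij; have [j' j'0] := gamma_surj ord0.
have [i' Pij'] := colP j'.
have [] := @staircase i j i' j'; rewrite ?i0 ?j'0 //.
by move=> _ ->.
Qed.

Lemma linked_last_row i j : rho i = ord_max -> gamma j != ord_max -> P i j = 0.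
Proof.
move=> i1; apply: contraNeq => Pij; have [j' j'1] := gamma_surj ord_max.
have [i' Qij'] := colQ j'.
have [] := @staircase i' j' i j; rewrite ?i1 ?j'1 ?leq_ord //.
by move=> _ <-.
Qed.

Lemma linked_last_col i j : gamma j = ord_max -> rho i != ord_max -> Q i j = 0.
Proof.
move=> j1; apply: contraNeq => Qij; have [i' i'1] := rho_surj ord_max.
have [j' Pij'] := rowP i'.
have [] := @staircase i j i' j'; rewrite ?i'1 ?j1 ?leq_ord //.
by move=> ->.
Qed.

(** Row [i] of [Q] and column [j] of [P] are non-zero, and by the vanishing already shown their
    non-zero entries lie in the corner block. Hence both matrices are non-zero there. *)
Lemma linked_first_block i j : rho i = ord0 -> gamma j = ord0 ->
  Q i j = d i * P i j * b j.
Proof.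
move=> i0 j0; have [_ _ _ tight] := PQ.
have [j2 Qj2] := rowQ i; have [i1 Pi1] := colP j.
apply: (tight _ _ _ _ _ _ _ _ _ _ Pi1 Qj2) => //.
  rewrite i0; apply/eqP; apply: contraNT Pi1 => ?.
  by rewrite linked_first_col.
rewrite j0; apply/eqP; apply: contraNT Qj2 => ?.
by rewrite linked_first_row.
Qed.

Lemma linked_last_block i j : rho i = ord_max -> gamma j = ord_max ->
  Q i j = d i * P i j * b j.
Proof.
move=> i0 j0; have [_ _ _ tight] := PQ.
have [i2 Qi2] := colQ j; have [j1 Pj1] := rowP i.
apply: (tight _ _ _ _ _ _ _ _ _ _ Pj1 Qi2) => //.
  rewrite j0; apply/eqP; apply: contraNT Pj1 => ?.
  by rewrite linked_last_row.
rewrite i0; apply/eqP; apply: contraNT Qi2 => ?.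
by rewrite linked_last_col.
Qed.

(** A single block row forces a single block column, and conversely, since otherwise [Q] would have
    a zero column or [P] a zero row... in either case the corner block is the whole matrix. For
    distinct shapes this rules out $l=1$ and $m=1$. *)
Lemma linked_single_block :
  (l == 0)%N || (c == 0)%N -> forall i j, Q i j = d i * P i j * b j.
Proof.
move=> lc.
have ord_eq0 p (x : 'I_p.+1) : p == 0%N -> x = ord0.
  by move=> /eqP p0; apply/val_inj/eqP; rewrite -leqn0 (leq_trans (leq_ord x)) ?p0.
suff /andP[l0 c0] : (l == 0)%N && (c == 0)%N.
  by move=> i j; apply: linked_first_block; exact: ord_eq0.
case/orP: lc => z0; rewrite z0 ?andbT /=.
  have [j jm] := gamma_surj ord_max; apply/eqP; apply: contraPeq (colQ j) => c0 [i].
  apply/negP; rewrite negbK; apply/eqP/linked_first_row.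
    exact: ord_eq0.
  by rewrite jm -val_eqE /=.
have [i im] := rho_surj ord_max; apply/eqP; apply: contraPeq (rowP i) => l0 [j].
apply/negP; rewrite negbK; apply/eqP/linked_first_col.
  exact: ord_eq0.
by rewrite im -val_eqE /=.
Qed.

Lemma linked_entries_blocks :
  exists (h : 'I_l.+1 -> nat) (w : 'I_c.+1 -> nat)
    (hm : (\sum_r h r)%N = m) (wn : (\sum_s w s)%N = n)
    (sigma : 'S_m) (tau : 'S_n)
    (P' Q' : forall r s, 'M[R]_(h r, w s))
    (D : forall r, 'M[R]_(h r)) (B : forall s, 'M[R]_(w s)),
    [/\ row_perm sigma (col_perm tau P) = castmx (hm, wn) (\mxblock_(r, s) P' r s),
        row_perm sigma (col_perm tau Q) = castmx (hm, wn) (\mxblock_(r, s) Q' r s),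
        (forall r, 0 < h r)%N /\ (forall s, 0 < w s)%N,
        (forall r, is_diag_mx (D r) /\ D r \in unitmx) /\
        (forall s, B s \in unitmx) &
        linked_blocks P' Q' D B].
Proof.
have [h [hm [sigma [h0 sigmaE]]]] := class_reindex rho_surj.
have [w [wn [tau [w0 tauE]]]] := class_reindex gamma_surj.
pose x r i := sigma (cast_ord hm (@tagnat.Rank _ h r i)).
pose y s j := tau (cast_ord wn (@tagnat.Rank _ w s j)).
have rhox r i : rho (x r i) = r by rewrite sigmaE tagnat.Rank1K.
have gammay s j : gamma (y s j) = s by rewrite tauE tagnat.Rank1K.
pose blk (M : 'M[R]_(m, n)) r s : 'M[R]_(h r, w s) := \matrix_(i, j) M (x r i) (y s j).
have blk_cast (M : 'M[R]_(m, n)) :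
    row_perm sigma (col_perm tau M) = castmx (hm, wn) (\mxblock_(r, s) blk M r s).
  by apply/matrixP => i j; rewrite castmxE !mxE /x /y !tagnat.sig2K !cast_ordKV.
have blk_eq0 (M : 'M[R]_(m, n)) r s :
    (forall i j, rho i = r -> gamma j = s -> M i j = 0) -> blk M r s = 0.
  by move=> M0; apply/matrixP => i j; rewrite !mxE M0.
have blk_neq0 (M : 'M[R]_(m, n)) r s : blk M r s != 0 ->
    exists i j, [/\ rho i = r, gamma j = s & M i j != 0].
  move=> Mrs; apply: contrapT => M0; case/eqP: Mrs; apply: blk_eq0 => i j ir js.
  by apply/eqP; apply: contrapT => Mij; apply: M0; exists i, j; split=> //; apply/negP.
have [_ [d0 b0] _ tight] := PQ.
pose D r := diag_mx (\row_i d (x r i)) : 'M[R]_(h r).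
pose B s := diag_mx (\row_j b (y s j)) : 'M[R]_(w s).
have unit_diag p (v : 'rV[R]_p) : (forall i, v 0 i != 0) -> diag_mx v \in unitmx.
  by move=> v0; rewrite unitmxE det_diag unitfE; apply/prodf_neq0.
have blk_link r s :
    (forall i j, rho i = r -> gamma j = s -> Q i j = d i * P i j * b j) ->
    blk Q r s = D r *m blk P r s *m B s.
  move=> QP; apply/matrixP => i j.
  by rewrite mul_mx_diag mxE mul_diag_mx !mxE QP.
exists h, w, hm, wn, sigma, tau, (blk P), (blk Q), D, B; split=> //.
  split=> [r|s]; last by apply: unit_diag => j; rewrite mxE.
  by split; [exact: diag_mx_is_diag | apply: unit_diag => i; rewrite mxE].
split.
- split=> [r r0|s s0]; apply: blk_eq0 => i j ir js.
    by apply: linked_first_col; rewrite // ir.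
  by apply: linked_last_row; rewrite // js.
- split=> [s s0|r r0]; apply: blk_eq0 => i j ir js.
    by apply: linked_first_row; rewrite // js.
  by apply: linked_last_col; rewrite // ir.
- split; apply: blk_link => i j; [exact: linked_first_block|exact: linked_last_block].
- move=> r s /blk_neq0[i1 [j1 [ir1 js1 P1]]] /blk_neq0[i2 [j2 [ir2 js2 Q2]]].
  by apply: blk_link => i j ir js; apply: (tight _ _ _ _ _ _ _ _ _ _ P1 Q2); rewrite ?ir ?js.
(* Conditions (iii) and (iv): two non-zero blocks in a forbidden position contain non-zero entries,
   and the staircase condition puts these into the same block. *)
split=> r s [a [t [ats + + /blk_neq0[i1 [j1 [ir1 js1 n1]]]]]] => ar st;
  apply/eqP; apply: contraNT ats => /blk_neq0[i2 [j2 [ir2 js2 n2]]].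
  have [] := staircase _ _ n1 n2; rewrite ?ir1 ?js1 ?ir2 ?js2 //.
  by move=> -> ->.
have [] := staircase _ _ n2 n1; rewrite ?ir1 ?js1 ?ir2 ?js2 //.
by move=> -> ->.
Qed.

End LinkedEntries.

(** * From block form to approximating sequences *)

Lemma mxdiag_mul (R : pzSemiRingType) p (p_ : 'I_p -> nat) (A B : forall i, 'M[R]_(p_ i)) :
  \mxdiag_i A i *m \mxdiag_i B i = \mxdiag_i (A i *m B i).
Proof.
rewrite {2}/mxdiag mul_mxdiag_mxblock /mxdiag; apply/eq_mxblock => i j.
by case: eqP => [ij|_]; [case: _ / ij; rewrite !conform_mx_id | rewrite mulmx0].
Qed.

Lemma mxdiag_unit (R : comUnitRingType) p (p_ : 'I_p -> nat) (A : forall i, 'M[R]_(p_ i)) :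
  (forall i, A i \in unitmx) -> \mxdiag_i A i \in unitmx.
Proof.
move=> uA; suff /mulmx1_unit[] : \mxdiag_i A i *m \mxdiag_i invmx (A i) = 1%:M by [].
by rewrite mxdiag_mul -mxdiagZ; apply: eq_mxdiag => i; rewrite mulmxV.
Qed.

(** Rows get the odd exponents $2r+1$. A column in which [p] and [q] meet copies the exponent of the
    unique common row; any other column gets an even number just above the exponents of its
    [p]-rows, hence below those of its [q]-rows. *)
Lemma staircase_exponents l c (p q : 'I_l -> 'I_c -> bool) :
  (forall r a s, p r s -> q a s -> (r <= a)%N) ->
  exists (u : 'I_l -> nat) (v : 'I_c -> nat), forall r s,
    [/\ p r s -> q r s -> u r = v s, p r s -> ~~ q r s -> (u r < v s)%N &
        ~~ p r s -> q r s -> (v s < u r)%N].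
Proof.
move=> pq; pose u (r : 'I_l) := r.*2.+1.
pose v s := if [pick r | p r s && q r s] is Some r then r.*2.+1
            else (\max_(r | p r s) r.+1).*2.
exists u, v => r s; rewrite /u /v; case: pickP => [r0 /andP[pr0 qr0]|no_pq].
  split=> [pr qr|pr nqr|npr qr].
  - by congr (_.*2.+1); apply/anti_leq; rewrite (pq _ _ s) // (pq _ _ s).
  - rewrite ltnS ltn_double ltn_neqAle (pq _ _ s) // andbT.
    by apply: contraNneq nqr => /val_inj ->.
  - rewrite ltnS ltn_double ltn_neqAle (pq _ _ s) // andbT.
    by apply: contraNneq npr => /val_inj <-.
split=> [pr qr|pr nqr|npr qr].
- by have := no_pq r; rewrite pr qr.
- by rewrite -doubleS leq_double; apply: leq_bigmax_cond.
rewrite ltnS leq_double; apply/bigmax_leqP => r' pr'.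
rewrite ltn_neqAle (pq _ _ s) // andbT.
by apply: contraNneq npr => /val_inj <-.
Qed.

Lemma entries_bounded (R : realType) m n (A : 'M[R]_(m, n)) :
  exists2 C : R, 0 <= C & entries_le C A.
Proof.
exists (\sum_i \sum_j `|A i j|) => [|i j].
  by apply: sumr_ge0 => i _; apply: sumr_ge0.
rewrite (bigD1 i) //= (bigD1 j) //= -addrA lerDl addr_ge0 //.
  by apply: sumr_ge0.
by apply: sumr_ge0 => i' _; apply: sumr_ge0.
Qed.

(* Rows of block r are scaled by t^-(u r) and columns of block s by t^(v s), so
   a block of P is sent to t^(v s - u r) times itself, and the exponents make
   this agree with Q up to terms that vanish with t. *)
Lemma linked_blocks_linkable (R : realType) l c (h : 'I_l.+1 -> nat) (w : 'I_c.+1 -> nat)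
    (P Q : forall r s, 'M[R]_(h r, w s))
    (D : forall r, 'M[R]_(h r)) (B : forall s, 'M[R]_(w s)) :
  (forall r, is_diag_mx (D r) /\ D r \in unitmx) -> (forall s, B s \in unitmx) ->
  linked_blocks P Q D B ->
  linkable (\mxblock_(r, s) P r s) (\mxblock_(r, s) Q r s).
Proof.
move=> dD uB [_ _ _ PQ [P0 _]] e e0.
have uD r : D r \in unitmx by case: (dD r).
(* Condition (iii) within one block column: a non-zero block of [P] never lies below a non-zero
   block of [Q]. *)
have [|u [v uv]] := @staircase_exponents _ _ (fun r s => P r s != 0) (fun r s => Q r s != 0).
  move=> r a s Prs Qas; rewrite leqNgt; apply: contra_neqN Prs => ar; apply: P0.
  exists a, s; split=> //; last exact: ltnW.
  by rewrite xpair_eqE negb_and -val_eqE /= ltn_eqF.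
pose X r s := D r *m P r s *m B s.
pose Z r s := invmx (D r) *m Q r s *m invmx (B s).
have Z0 r s : Q r s = 0 -> Z r s = 0 by rewrite /Z => ->; rewrite mulmx0 mul0mx.
have [C1 C10 C1X] := entries_bounded (\mxblock_(r, s) X r s).
have [C2 C20 C2Z] := entries_bounded (\mxblock_(r, s) Z r s).
pose C := C1 + C2 + 1.
have C0 : 0 < C by rewrite ltr_wpDl // addr_ge0.
(* This choice gives $0<t\le 1$ and $tC<e$, so every positive power of $t$ times an entry bounded by
   $C$ is smaller than $e$. *)
pose t := e / (e + C).
have eC0 : 0 < e + C by rewrite addr_gt0.
have t0 : 0 < t by rewrite divr_gt0.
have t1 : t <= 1 by rewrite ler_pdivrMr // mul1r lerDl ltW.
have tC : t * C < e by rewrite mulrAC ltr_pdivrMr // ltr_pM2l // ltrDr.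
have small x k : (0 < k)%N -> `|x| <= C -> `|t ^+ k * x| < e.
  case: k => // k _ xC; apply: le_lt_trans tC.
  rewrite normrM ler_pM // normrX (gtr0_norm t0) exprS ler_piMr ?(ltW t0) //.
  by rewrite exprn_ile1 // ltW.
(* Where [P] vanishes, a small block is inserted that the scaling blows up to exactly [Q r s]. If
   [Q r s] is zero too, then so is [Z r s], and the truncated subtraction does no harm. *)
pose Pt r s := if P r s == 0 then t ^+ (u r - v s) *: Z r s else P r s.
pose Dt r := (t ^+ u r)^-1 *: D r; pose Bt s := t ^+ v s *: B s.
pose Qt r s := Dt r *m Pt r s *m Bt s.
have QtE r s : Qt r s = if P r s == 0 then Q r s
                        else if Q r s == 0 then t ^+ (v s - u r) *: X r s else Q r s.
  have [uvE ult vlt] := uv r s.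
  rewrite /Qt /Dt /Bt /Pt -scalemxAr -!scalemxAl scalerA.
  have tn0 k : t ^+ k != 0 by rewrite expf_neq0 // gt_eqF.
  case: (eqVneq (P r s) 0) => [Prs|Prs].
    rewrite -scalemxAr -scalemxAl !scalerA.
    have -> : D r *m Z r s *m B s = Q r s.
      by rewrite /Z !mulmxA mulmxV // mul1mx mulmxKV.
    case: (eqVneq (Q r s) 0) => [->|Qrs]; first by rewrite scaler0.
    move: vlt; rewrite Prs eqxx Qrs => /(_ isT isT) vlt.
    rewrite expfB // mulrCA -mulrA; set a := t ^+ _; set b := t ^+ _.
    by rewrite (_ : _ * _ = 1) ?scale1r //; field; rewrite !tn0.
  case: (eqVneq (Q r s) 0) => [Qrs|Qrs].
    by rewrite expfB // ult // Qrs eqxx.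
  by rewrite uvE // divff // scale1r PQ.
exists (\mxblock_(r, s) Pt r s), (\mxblock_(r, s) Qt r s).
have diagDt : is_diag_mx (\mxdiag_r Dt r).
  apply/is_diag_mxblockP; split=> [r r' /negPf ->|r] //.
  rewrite eqxx conform_mx_id; have [/is_diag_mxP diagDr _] := dD r.
  by apply/is_diag_mxP => i j ij; rewrite mxE diagDr ?mulr0.
have /diag_mxP[delta deltaE] := diagDt.
exists delta, (\mxdiag_s Bt s); split.
- have : \mxdiag_r Dt r \in unitmx.
    apply: mxdiag_unit => r; rewrite unitmxZ // unitfE invr_eq0 expf_neq0 // gt_eqF //.
  rewrite deltaE unitmxE det_diag unitfE => /prodf_neq0 dn0 i; exact: dn0.
- apply: mxdiag_unit => s; rewrite unitmxZ // unitfE expf_neq0 // gt_eqF //.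
- by rewrite -deltaE mul_mxdiag_mxblock mul_mxblock_mxdiag.
- move=> i j; rewrite !mxE /Pt; set r := tagnat.sig1 i; set s := tagnat.sig1 j.
  case: eqVneq => [Prs|_]; last by rewrite subrr normr0.
  rewrite Prs [X in X - _]mxE [X in _ - X]mxE subr0.
  have [Q0|Qrs] := eqVneq (Q r s) 0.
    by rewrite Z0 // mxE mulr0 normr0.
  apply: small; first by rewrite subn_gt0; have [_ _] := uv r s; apply; rewrite ?Prs ?eqxx.
  by have := C2Z i j; rewrite mxE => /le_trans; apply; rewrite /C -addrA addrCA lerDl addr_ge0.
move=> i j; rewrite [X in X - _]mxE [X in _ - X]mxE QtE; set r := tagnat.sig1 i; set s := tagnat.sig1 j.
case: eqVneq => [_|Prs]; first by rewrite subrr normr0.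
case: eqVneq => [Qrs|_]; last by rewrite subrr normr0.
rewrite Qrs [X in X - _]mxE [X in _ - X]mxE subr0; apply: small.
  by rewrite subn_gt0; have [_ + _] := uv r s; apply; rewrite ?Qrs ?eqxx.
by have := C1X i j; rewrite mxE => /le_trans; apply; rewrite /C -addrA lerDl addr_ge0.
Qed.

(** * Topology of the space of shapes *)

Lemma mx_cvgP (R : realType) (T : Type) (F : set_system T) {FF : Filter F} m n
    (A_ : T -> 'M[R]_(m, n)) (A : 'M[R]_(m, n)) :
  mx_cvg F A_ A <-> A_ t @[t --> F] --> A.
Proof.
split=> [cA B [S AS SB]|cA i j].
  apply: (@filterS _ F _ _ _ _ (@filter_forall T 'I_m
    (fun i => [set t | forall j, S i j (A_ t i j)]) F FF _)).
    by move=> t St; apply: SB => i j; exact: St.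
  move=> i; apply: (@filter_forall T 'I_n (fun j => [set t | S i j (A_ t i j)]) F FF).
  by move=> j; exact: (cA i j _ (AS i j)).
exact: (cvg_comp _ _ cA (@coord_continuous R m n i j A)).
Qed.

Definition entries_close (R : realType) m n (e : R) (A B : 'M[R]_(m, n)) : Prop :=
  forall i j, `|A i j - B i j| < e.

Lemma nbhs_entries_close (R : realType) m n (A : 'M[R]_(m, n)) (S : set 'M[R]_(m, n)) :
  nbhs A S <-> exists2 e : R, 0 < e & forall B, entries_close e B A -> S B.
Proof.
split=> [/nbhs_ballP[e e0 eS]|[e e0 eS]].
  by exists e => // B BA; apply: eS; split=> // i j; rewrite /ball /= distrC; exact: BA.
apply/nbhs_ballP; exists e => // B [_ AB]; apply: eS => i j; rewrite distrC; exact: AB.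
Qed.

Section ShapeTopology.
Variables (R : realType) (d : nat).

Lemma nzvec_cvg (T : Type) (F : set_system T) {FF : Filter F}
    (f : T -> nzvec R d) (v : nzvec R d) :
  \val (f t) @[t --> F] --> \val v -> f t @[t --> F] --> v.
Proof.
move=> fv A [_ [[B oB <-] Bv] BA].
have FB : F [set t | B (\val (f t))] by apply: fv; exact: open_nbhs_nbhs.
by apply: (@filterS _ F _ _ (fun t => A (f t)) _ FB) => t Bt; exact: BA.
Qed.

Lemma val_nzvec_continuous : continuous (\val : nzvec R d -> 'rV[R]_d.+1).
Proof. exact: initial_continuous. Qed.

Lemma nzvec_act_continuous (g : GL R d) : continuous (nzvec_act g).
Proof.
move=> v; apply: (@nzvec_cvg _ (nbhs v)) => /=.
have : mx_cvg (nbhs v) (fun t : nzvec R d => \val t *m \val g) (\val v *m \val g).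
  apply: mx_cvg_mul; last by move=> i j; exact: cvg_cst.
  by apply/mx_cvgP; exact: val_nzvec_continuous.
by move=> /mx_cvgP h; exact: h.
Qed.

Lemma RP_act_continuous (g : GL R d) : continuous (@RP_act R d g).
Proof.
apply/quotient_continuous; rewrite (_ : _ \o _ = \pi_(RP R d) \o nzvec_act g); last first.
  by apply/funext => v; rewrite /= RP_act_pi.
by move=> v; apply: continuous_comp; [exact: nzvec_act_continuous | exact: pi_continuous].
Qed.

Lemma same_line_scale (u v : nzvec R d) :
  reflect (exists2 c, c != 0 & \val u = c *: \val v) (same_line u v).
Proof.
apply: (iffP idP) => [/eqmxP uv|[c c0 uv]]; last first.
  by rewrite /same_line uv; apply/eqmxP/eqmx_scale.
have /sub_rVP[c uE] : (\val u <= \val v)%MS by rewrite uv.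
exists c => //; apply/eqP => c0; have /eqP := set_mem (valP u); apply.
by rewrite -[LHS]/(\val u) uE c0 scale0r.
Qed.

Lemma scalar_unit (c : R) : c != 0 -> (c%:M : 'M[R]_d.+1) \in unitmx.
Proof. by move=> c0; rewrite unitmxE det_scalar unitfE expf_neq0. Qed.

(** If $u=cv$ lies in [U], scaling by $c$ carries a neighbourhood of $v$ into [U]; hence the
    saturation of [U] is open. The same argument with a matrix $g$ in place of $c$ gives
    [shape_of_open]. *)
Lemma pi_RP_open (U : set (nzvec R d)) : open U -> open (\pi_(RP R d) @` U).
Proof.
move=> oU; rewrite /open /= /quotient_open openE => v [u Uu /RP_eqP].
move=> /same_line_scale[c c0 uE].
pose g : GL R d := exist _ c%:M (scalar_unit c0).
have gv : nzvec_act g v = u by apply: val_inj; rewrite /= mul_mx_scalar uE.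
have : nbhs v (nzvec_act g @^-1` U).
  by apply: nzvec_act_continuous; rewrite gv; exact: open_nbhs_nbhs.
apply: filterS => t Ut; exists (nzvec_act g t) => //.
by apply/RP_eqP/same_line_scale; exists c; rewrite //= mul_mx_scalar.
Qed.

Variable k : nat.

Lemma config_cvg (T : Type) (F : set_system T) {FF : Filter F}
    (f : T -> config R d k) (p : config R d k) :
  (forall i, f t i @[t --> F] --> p i) -> f t @[t --> F] --> p.
Proof.
move=> fp; apply/cvg_sup => i A [_ [[B oB <-] Bp] BA].
have FB : F [set t | B (f t i)] by apply: (fp i); exact: open_nbhs_nbhs.
by apply: (@filterS _ F _ _ (fun t => A (f t)) _ FB) => t Bt; exact: BA.
Qed.

Lemma config_proj_continuous (i : 'I_k) : continuous (fun p : config R d k => p i).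
Proof. exact: (@proj_continuous 'I_k (fun=> RP R d) i). Qed.

Lemma config_act_continuous (g : GL R d) : continuous (@config_act R d k g).
Proof.
move=> p; apply: (@config_cvg _ (nbhs p)) => i.
exact: (cvg_comp _ _ (@config_proj_continuous i p) (@RP_act_continuous g (p i))).
Qed.

Lemma shape_ofP (p q : config R d k) :
  shape_of p = shape_of q <-> exists g, q = config_act g p.
Proof.
rewrite /shape_of; split=> [/(@eqmodP _ (same_orbit_equiv R d k))/asboolP //|h].
by apply/(@eqmodP _ (same_orbit_equiv R d k))/asboolP.
Qed.

Lemma shape_of_open (W : set (config R d k)) : open W -> open (shape_of @` W).
Proof.
move=> oW; rewrite /open /= /quotient_open openE => p [q Wq /esym/shape_ofP[g qE]].
have : nbhs p (config_act g @^-1` W).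
  by apply: config_act_continuous; rewrite -qE; exact: open_nbhs_nbhs.
apply: filterS => t Wt; exists (config_act g t) => //.
by apply/esym/shape_ofP; exists g.
Qed.

Lemma shape_of_continuous : continuous (shape_of : config R d k -> shapes R d k).
Proof. exact: pi_continuous. Qed.

(** This is where openness of both quotient maps enters: small perturbations of the rows of [P] fill
    a neighbourhood of the shape. *)
Lemma shape_nbhs_of_close (P : 'M[R]_(k, d.+1)) (p : config R d k) (e : R) :
  represents P p -> 0 < e ->
  nbhs (shape_of p) (shape_of @`
    [set p' | exists2 P', represents P' p' & entries_close e P' P]).
Proof.
move=> Pp e0; set W := [set p' | _].
pose V i : set (nzvec R d) := [set v | entries_close e (\val v) (row i P)].
have nV i (v : nzvec R d) : \val v = row i P -> nbhs v (V i).
  move=> vE.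
  have nB : nbhs (\val v) [set x | entries_close e x (row i P)].
    by rewrite vE; apply/nbhs_entries_close; exists e.
  exact: (@val_nzvec_continuous v _ nB).
have nW : nbhs p W.
  have nWi : forall i, nbhs p [set p' : config R d k | (\pi_(RP R d) @` (V i)°) (p' i)].
    move=> i; have [v vE pE] := Pp i.
    have nB : nbhs (p i) (\pi_(RP R d) @` (V i)°).
      apply: open_nbhs_nbhs; split; first by apply: pi_RP_open; exact: open_interior.
      by rewrite pE; exists v => //; exact: nV.
    exact: (@config_proj_continuous i p _ nB).
  have nWa : nbhs p [set p' : config R d k | forall i, (\pi_(RP R d) @` (V i)°) (p' i)].
    exact: (@filter_forall _ _
      (fun i => [set p' : config R d k | (\pi_(RP R d) @` (V i)°) (p' i)]) _ _ nWi).
  apply: filterS nWa => p' p'V.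
  have /choice[v vP] : forall i, exists v, V i v /\ p' i = \pi_(RP R d) v.
    by move=> i; have [v /interior_subset Vv <-] := p'V i; exists v.
  exists (\matrix_i \val (v i)) => i.
    by exists (v i); [rewrite rowK | exact: (vP i).2].
  by move=> j; have := (vP i).1 0 j; rewrite !mxE.
have nWo : nbhs (shape_of p) (shape_of @` W°).
  apply: open_nbhs_nbhs; split; first by apply: shape_of_open; exact: open_interior.
  by exists p.
apply: filterS nWo => _ [q /interior_subset Wq <-]; by exists q.
Qed.

(** This direction is continuity of the map from matrices to shapes near [P]. *)
Lemma close_of_shape_nbhs (P : 'M[R]_(k, d.+1)) (p : config R d k)
    (U : set (shapes R d k)) :
  represents P p -> nbhs (shape_of p) U ->
  exists2 e : R, 0 < e & forall P', entries_close e P' P ->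
    exists2 p', represents P' p' & U (shape_of p').
Proof.
move=> Pp nU; have [v vP] : exists v : 'I_k -> nzvec R d,
    forall i, \val (v i) = row i P /\ p i = \pi_(RP R d) (v i).
  have /choice[v vP] : forall i, exists v : nzvec R d,
    \val v = row i P /\ p i = \pi_(RP R d) v; last by exists v.
  by move=> i; have [v vE pE] := Pp i; exists v.
(* The default [v i] is used only for a zero row, which does not occur close enough to [P]. *)
pose nz i (x : 'rV[R]_d.+1) : nzvec R d := insubd (v i) x.
pose G (M : 'M[R]_(k, d.+1)) : config R d k := fun i => \pi_(RP R d) (nz i (row i M)).
have row_neq0 i : row i P != 0 by have [<- _] := vP i; exact: (set_mem (valP (v i))).
have row_cvg i : row i M @[M --> P] --> row i P.
  apply/(@mx_cvgP _ _ (nbhs P)) => i' j; rewrite mxE; under eq_cvg do rewrite mxE.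
  exact: coord_continuous.
have near_neq0 i : \forall M \near P, row i M != 0.
  exact: (cvgr_neq0 _ (row_cvg i) (row_neq0 i)).
have valnz i x : x != 0 -> \val (nz i x) = x.
  by move=> x0; rewrite /nz insubdK // inE.
have cG : G M @[M --> P] --> p.
  apply: (@config_cvg _ (nbhs P)) => i; have [vE pE] := vP i; rewrite pE.
  have cnz : nz i (row i M) @[M --> P] --> v i.
    apply: (@nzvec_cvg _ (nbhs P)); rewrite vE.
    apply: cvg_trans (row_cvg i); apply: near_eq_cvg.
    by near=> M; rewrite valnz //; near: M; exact: near_neq0.
  exact: (cvg_comp _ _ cnz (@pi_continuous _ _ (v i))).
have nU' : nbhs P [set M | U (shape_of (G M))].
  exact: (cG _ (@shape_of_continuous p _ nU)).
have nrow : nbhs P [set M | forall i, row i M != 0].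
  exact: (@filter_forall _ _ (fun i => [set M | row i M != 0]) _ _ near_neq0).
have /nbhs_entries_close[e e0 eP] : nbhs P ([set M | U (shape_of (G M))] `&`
    [set M | forall i, row i M != 0]) by exact: filterI.
exists e => // P' /eP[UP' P'0]; exists (G P') => // i.
by exists (nz i (row i P')); rewrite // valnz.
Unshelve. all: by end_near. Qed.

End ShapeTopology.

(** * Inseparable shapes *)

(** Neighbourhoods are taken in the ambient space; the subspace enters only through the demand that
    the common point lie in [Y]. *)
Lemma not_hausdorff_subspaceP (T : topologicalType) (Y : set T) :
  ~ hausdorff_space (set_type Y) <->
  exists x y, [/\ Y x, Y y, x <> y &
    forall U V, nbhs x U -> nbhs y V -> exists z, [/\ Y z, U z & V z]].
Proof.
split=> [nH|[x [y [Yx Yy xy insep]]] H].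
  have [x [y [cxy xy]]] : exists x y : set_type Y, cluster (nbhs x) y /\ x <> y.
    apply: contrapT => h; apply: nH => x y cxy; apply: contrapT => xy.
    by apply: h; exists x, y.
  exists (set_val x), (set_val y); split; [exact: set_mem (valP x)|exact: set_mem (valP y)| |].
    by move=> /val_inj.
  move=> U V /initial_continuous nU /initial_continuous nV.
  have [z [Uz Vz]] := cxy _ _ nU nV.
  by exists (set_val z); split=> //; exact: set_mem (valP z).
pose x' : set_type Y := SigSub (mem_set Yx); pose y' : set_type Y := SigSub (mem_set Yy).
have : x' = y'; last by move=> /(congr1 set_val).
apply: H => A B [_ [[U oU <-] Ux] UA] [_ [[V oV <-] Vy] VB].
have [z [Yz Uz Vz]] := insep U V (open_nbhs_nbhs (conj oU Ux)) (open_nbhs_nbhs (conj oV Vy)).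
by exists (SigSub (mem_set Yz)); split; [exact: UA | exact: VB].
Qed.

(** * Matrices representing a configuration or a shape *)

Section Representatives.
Variables (R : realType) (d k : nat).
Implicit Types (P Q : 'M[R]_(k, d.+1)) (p q : config R d k).

Lemma represents_row_neq0 P p i : represents P p -> row i P != 0.
Proof. by move=> /(_ i)[v <- _]; exact: (set_mem (valP v)). Qed.

Lemma represents_config_mx p : represents (config_mx p) p.
Proof. by move=> i; exists (repr (p i)); rewrite ?rowK ?reprK. Qed.

Lemma represents_act P p (g : GL R d) :
  represents P p -> represents (P *m \val g) (config_act g p).
Proof.
move=> Pp i; have [v vE pE] := Pp i; exists (nzvec_act g v).
  by rewrite row_mul -vE.
by rewrite /config_act pE RP_act_pi.
Qed.

Lemma represents_diag P p (c : 'rV[R]_k) : (forall i, c 0 i != 0) ->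
  represents P p -> represents (diag_mx c *m P) p.
Proof.
move=> c0 Pp i; have [v vE pE] := Pp i.
pose g : GL R d := exist _ (c 0 i)%:M (scalar_unit _ (c0 i)).
exists (nzvec_act g v).
  by rewrite /= mul_mx_scalar vE; apply/rowP => j; rewrite mul_diag_mx !mxE.
rewrite pE; apply/esym/RP_eqP/same_line_scale; exists (c 0 i) => //.
by rewrite /= mul_mx_scalar.
Qed.

Lemma represents_unique P P' p : represents P p -> represents P' p ->
  exists2 c : 'rV[R]_k, forall i, c 0 i != 0 & P' = diag_mx c *m P.
Proof.
move=> Pp P'p.
have /choice[c cP] : forall i, exists c, c != 0 /\ row i P' = c *: row i P.
  move=> i; have [v <- pE] := Pp i; have [v' <-] := P'p i.
  by rewrite pE => /esym/RP_eqP/same_line_scale[c c0 vE]; exists c.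
exists (\row_i c i) => [i|]; first by rewrite mxE; have [] := cP i.
apply/row_matrixP => i; have [_ ->] := cP i.
by apply/rowP => j; rewrite mul_diag_mx !mxE.
Qed.

Lemma rk_represents P p (I : {set 'I_k}) : represents P p ->
  rk p I = \rank (rowsub (fun i : 'I_#|I| => enum_val i) P).
Proof.
move=> Pp; have [c c0 cE] := represents_unique Pp (represents_config_mx p).
rewrite /rk /subconfig_mx cE; set f := fun _ => _.
have -> : rowsub f (diag_mx c *m P) = diag_mx (\row_i c 0 (f i)) *m rowsub f P.
  by apply/matrixP => i j; rewrite mxE !mul_diag_mx !mxE.
rewrite (eqmxMfull (rowsub f P)) // row_full_unit unitmxE det_diag unitfE.
by apply/prodf_neq0 => i _; rewrite mxE.
Qed.

Lemma full_rank_represents P p : represents P p ->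
  full_rank_shapes R d k (shape_of p) -> \rank P = d.+1.
Proof.
move=> Pp [q fq /shape_ofP[g pE]].
have := represents_act g (represents_config_mx q); rewrite -pE => Qp.
have [c c0 ->] := represents_unique Qp Pp.
have uc : diag_mx c \in unitmx by rewrite unitmxE det_diag unitfE; apply/prodf_neq0.
rewrite (eqmxMfull _ _) ?row_full_unit // mxrankMfree ?row_free_unit ?(valP g) //.
Qed.

Lemma same_shapeP P Q p q : represents P p -> represents Q q ->
  shape_of p = shape_of q <->
  exists (c : 'rV[R]_k) (B : 'M[R]_d.+1),
    [/\ forall i, c 0 i != 0, B \in unitmx & Q = diag_mx c *m P *m B].
Proof.
move=> Pp Qq; split=> [/shape_ofP[g qE]|[c [B [c0 uB QE]]]].
  have := represents_act g Pp; rewrite -qE => Pq.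
  have [c c0 ->] := represents_unique Pq Qq.
  by exists c, (\val g); rewrite mulmxA; split=> //; exact: (valP g).
pose g : GL R d := exist _ B uB.
have := represents_act g (represents_diag c0 Pp); rewrite /= -QE => Qp.
apply/shape_ofP; exists g; apply/funext => i.
by have [v vE ->] := Qq i; have [v' v'E ->] := Qp i; congr (\pi_ _ _); apply: val_inj; rewrite vE v'E.
Qed.

End Representatives.

(** * Density of general position and inseparability *)

(** [P] is moved along a Vandermonde matrix [W], all of whose maximal minors are non-zero. A maximal
    minor of $P+tW$ vanishes only if $-t$ is an eigenvalue of $P_fW_f^{-1}$, which excludes finitely
    many $t$. *)
Lemma generic_close (R : realType) k n (P : 'M[R]_(k, n)) (e : R) : 0 < e ->
  exists2 P' : 'M[R]_(k, n), entries_close e P' P &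
    forall f : 'I_n -> 'I_k, injective f -> rowsub f P' \in unitmx.
Proof.
move=> e0; pose W : 'M[R]_(k, n) := \matrix_(i, j) (i%:R) ^+ j.
have uW (f : 'I_n -> 'I_k) : injective f -> rowsub f W \in unitmx.
  move=> f_inj; rewrite -unitmx_tr.
  have -> : (rowsub f W)^T = Vandermonde n (\row_j (f j)%:R).
    by apply/matrixP => i j; rewrite !mxE.
  rewrite unitmxE det_Vandermonde unitfE; apply/prodf_neq0 => i _.
  apply/prodf_neq0 => j ij; rewrite !mxE subr_eq0 eqr_nat.
  by apply: contraTneq ij => /val_inj/f_inj ->; rewrite ltnn.
have [C C0 WC] := entries_bounded W.
pose A (f : {ffun 'I_n -> 'I_k}) := rowsub f P *m invmx (rowsub f W).
(* The product runs over all maps [f]; characteristic polynomials are monic, so it is non-zero even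
   with the junk inverses at non-injective [f]. *)
pose chi := \prod_f char_poly (A f).
have chi0 : chi != 0 by apply/prodf_neq0 => f _; exact: monic_neq0 (char_poly_monic _).
pose t (i : nat) := e / (C + 1) / i.+1%:R.
have C1 : 0 < C + 1 by rewrite ltr_wpDl.
have t0 i : 0 < t i by rewrite !divr_gt0 // ltr0n.
have t_inj : injective (fun i => - t i).
  have a0 : e / (C + 1) != 0 by rewrite gt_eqF // divr_gt0.
  by move=> i j /oppr_inj/(mulfI a0)/invr_inj/eqP; rewrite eqr_nat eqSS => /eqP.
(* Among [size chi] distinct values one is not a root, as a non-zero polynomial has fewer roots than
   its size. *)
have [i ri] : exists i, ~~ root chi (- t i).
  apply: contrapT => h.
  have := @max_poly_roots _ chi [seq - t i | i <- iota 0 (size chi)] chi0.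
  rewrite size_map size_iota ltnn map_inj_uniq // iota_uniq => /(_ _ isT).
  suff all_root : all (root chi) [seq - t i | i <- iota 0 (size chi)].
    by move=> /(_ all_root).
  apply/allP => _ /mapP[i _ ->]; apply: contrapT => /negP nr.
  by apply: h; exists i.
exists (P + t i *: W) => [a b|f f_inj].
  rewrite [X in X - _]mxE [X in _ + X - _]mxE addrAC subrr add0r normrM.
  rewrite (gtr0_norm (t0 i)).
  apply: (@le_lt_trans _ _ (e / (C + 1) * C)).
    rewrite ler_pM ?(ltW (t0 _)) // /t ler_piMr ?divr_ge0 ?(ltW e0) ?(ltW C1) //.
    by rewrite invf_le1 ?ltr0n // ler1n.
  by rewrite mulrAC ltr_pdivrMr // ltr_pM2l // ltrDl.
have -> : rowsub f (P + t i *: W) = (A (finfun f) + (t i)%:M) *m rowsub f W.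
  rewrite mulmxDl mul_scalar_mx /A.
  have fE : rowsub (finfun f) W = rowsub f W by apply/matrixP => a b; rewrite !mxE ffunE.
  rewrite fE mulmxKV ?uW //; apply/matrixP => a b; rewrite !mxE ffunE //.
rewrite unitmx_mul uW // andbT -row_free_unit -kermx_eq0.
have : ~~ eigenvalue (A (finfun f)) (- t i).
  by rewrite eigenvalue_root_char; apply: contra ri => ri; rewrite /chi (bigD1 (finfun f)) //= rootM ri.
by rewrite /eigenvalue /eigenspace raddfN opprK negbK.
Qed.

Section Inseparable.
Variables (R : realType) (d k : nat) (P Q : 'M[R]_(k, d.+1)) (p q : config R d k).
Hypotheses (Pp : represents P p) (Qq : represents Q q).

Lemma inseparable_linkable :
  (forall U V, nbhs (shape_of p) U -> nbhs (shape_of q) V -> exists z, U z /\ V z) ->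
  linkable P Q.
Proof.
move=> insep e e0.
have [z [[p' [P' P'p' P'P] <-] [q' [Q' Q'q' Q'Q] qp']]] :=
  insep _ _ (shape_nbhs_of_close Pp e0) (shape_nbhs_of_close Qq e0).
have [c [B [c0 uB QE]]] := (same_shapeP P'p' Q'q').1 (esym qp').
by exists P', Q', c, B.
Qed.

Lemma general_shapes_of_unit P' p' : (d < k)%N -> represents P' p' ->
  (forall f : 'I_d.+1 -> 'I_k, injective f -> rowsub f P' \in unitmx) ->
  general_shapes R d k (shape_of p').
Proof.
move=> dk P'p' uP'; exists p' => // I cardI.
rewrite /row_free -[\rank _]/(rk p' I) (rk_represents I P'p') eqn_leq rank_leq_row /=.
pose f (i : 'I_d.+1) : 'I_k := enum_val (cast_ord (esym cardI) i).
have f_inj : injective f by move=> i j /enum_val_inj/cast_ord_inj.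
have /eqP rf : \rank (rowsub f P') == d.+1 by rewrite mxrank_unit // uP'.
rewrite [X in (X <= _)%N]cardI -[X in (X <= _)%N]rf; apply: mxrankS.
apply/row_subP => i; rewrite (_ : row i _ = row (cast_ord (esym cardI) i)
  (rowsub (fun i : 'I_#|I| => enum_val i) P')); first exact: row_sub.
by apply/rowP => j; rewrite !mxE.
Qed.

(** Linkability yields a shape common to open parts of [U] and [V]. A further perturbation inside
    their intersection brings it into general position, so the common shape belongs to every
    subspace containing those shapes. *)
Lemma linkable_inseparable U V : (d < k)%N -> linkable P Q ->
  nbhs (shape_of p) U -> nbhs (shape_of q) V ->
  exists z, [/\ general_shapes R d k z, U z & V z].
Proof.
move=> dk PQ; rewrite nbhsE => -[U' [oU' U'p] U'U]; rewrite nbhsE => -[V' [oV' V'q] V'V].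
have [e1 e10 eU] := close_of_shape_nbhs Pp (open_nbhs_nbhs (conj oU' U'p)).
have [e2 e20 eV] := close_of_shape_nbhs Qq (open_nbhs_nbhs (conj oV' V'q)).
have e0 : 0 < Num.min e1 e2 by rewrite lt_min e10.
have [P' [Q' [c [B [c0 uB QE P'P Q'Q]]]]] := PQ _ e0.
have [p' P'p' Up'] : exists2 p', represents P' p' & U' (shape_of p').
  by apply: eU => i j; apply: lt_le_trans (P'P i j) _; rewrite ge_min lexx.
have [q' Q'q' Vq'] : exists2 q', represents Q' q' & V' (shape_of q').
  by apply: eV => i j; apply: lt_le_trans (Q'Q i j) _; rewrite ge_min lexx orbT.
have pq' : shape_of p' = shape_of q' by apply/(same_shapeP P'p' Q'q'); exists c, B.
have nUV : nbhs (shape_of p') (U' `&` V').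
  by apply: open_nbhs_nbhs; split; [exact: openI | split=> //; rewrite pq'].
have [e3 e30 eUV] := close_of_shape_nbhs P'p' nUV.
have [P'' P''P' uP''] := generic_close P' e30.
have [p'' P''p'' [Up'' Vp'']] := eUV _ P''P'.
exists (shape_of p''); split; [|exact: U'U|exact: V'V].
exact: general_shapes_of_unit P''p'' uP''.
Qed.

End Inseparable.

(** * The proposition *)

Lemma linkable_row_perm (R : realType) m n (s : 'S_m) (P Q : 'M[R]_(m, n)) :
  linkable P Q -> linkable (row_perm s P) (row_perm s Q).
Proof.
move=> PQ e /PQ[P' [Q' [delta [B [d0 uB QE P'P Q'Q]]]]].
exists (row_perm s P'), (row_perm s Q'), (col_perm s delta), B; split=> //.
- by move=> i; rewrite mxE.
- rewrite QE row_permE mulmxA -row_permE; congr (_ *m B).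
  by apply/matrixP => i j; rewrite mxE !mul_diag_mx !mxE.
- by move=> i j; rewrite !mxE.
- by move=> i j; rewrite !mxE.
Qed.

Lemma linkable_castmx (R : realType) m n m' n' (em : m = m') (en : n = n')
    (P Q : 'M[R]_(m, n)) :
  linkable P Q -> linkable (castmx (em, en) P) (castmx (em, en) Q).
Proof. by case: _ / em; case: _ / en; rewrite !castmx_id. Qed.

(** * Rank estimates and subspace constraints *)

Lemma mxrank_support_cols (F : fieldType) m n (M : 'M[F]_(m, n)) (J : {set 'I_n}) :
  (forall i j, j \notin J -> M i j = 0) -> (\rank M <= #|J|)%N.
Proof.
move=> M0.
have /mxrankS : (M <= \sum_(j in J) <<delta_mx ord0 j : 'rV[F]_n>>)%MS.
  apply/row_subP => i; rewrite [row i M]row_sum_delta; apply: summx_sub => j _.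
  have [jJ|jJ] := boolP (j \in J); last by rewrite mxE M0 // scale0r sub0mx.
  by apply: scalemx_sub; rewrite (sumsmx_sup j) // genmxE.
move/leq_trans; apply; apply: leq_trans (mxrank_sum_leqif _).1 _ => /=.
by rewrite -sum1_card; apply: leq_sum => j _; rewrite mxrank_gen rank_leq_row.
Qed.

Lemma mxrank_split_rows (F : fieldType) m n (M : 'M[F]_(m, n)) (I : {set 'I_m}) :
  (\rank M <= \rank (rowsub (fun i : 'I_#|I| => enum_val i) M) + #|~: I|)%N.
Proof.
pose f (A : {set 'I_m}) (i : 'I_#|A|) : 'I_m := enum_val i.
have row_f (A : {set 'I_m}) i : i \in A -> (row i M <= rowsub (f A) M)%MS.
  move=> iA; rewrite (_ : row i M = row (enum_rank_in iA i) (rowsub (f A) M)) ?row_sub //.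
  by apply/rowP => j; rewrite !mxE /f enum_rankK_in.
have /mxrankS : (M <= rowsub (f I) M + rowsub (f (~: I)) M)%MS.
  apply/row_subP => i; have [iI|iI] := boolP (i \in I).
    by rewrite (submx_trans (row_f _ _ iI)) ?addsmxSl.
  by rewrite (submx_trans (row_f (~: I) i _)) ?inE ?addsmxSr.
move/leq_trans; apply; apply: leq_trans (mxrank_adds_leqif _ _).1 _.
by rewrite leq_add2l rank_leq_row.
Qed.

Lemma full_col_rank_neq0 (F : fieldType) m n (M : 'M[F]_(m, n)) j :
  \rank M = n -> exists i, M i j != 0.
Proof.
move=> rM; apply: contrapT => M0.
have : (\rank M <= #|(~: [set j])%SET|)%N.
  apply: mxrank_support_cols => i j'; rewrite !inE negbK => /eqP ->.
  by apply: contrapT => /eqP Mij; apply: M0; exists i.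
by rewrite rM cardsC1 card_ord leqNgt ltn_predL (leq_ltn_trans _ (ltn_ord j)).
Qed.

Lemma linkable_linked_entries (R : realType) d k (P Q : 'M[R]_(k, d.+1))
    (p q : config R d k) : (0 < k)%N ->
  represents P p -> represents Q q -> \rank P = d.+1 -> \rank Q = d.+1 ->
  shape_of p <> shape_of q -> linkable P Q ->
  exists (P1 Q1 : 'M[R]_(k, d.+1)) (l c : nat)
    (rho : 'I_k -> 'I_l.+1) (gamma : 'I_d.+1 -> 'I_c.+1)
    (dl : 'I_k -> R) (b : 'I_d.+1 -> R),
    [/\ represents_shape P1 (shape_of p) /\ represents_shape Q1 (shape_of q),
        (forall i, exists j, P1 i j != 0) /\ (forall i, exists j, Q1 i j != 0),
        \rank P1 = d.+1 /\ \rank Q1 = d.+1,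
        (0 < l)%N /\ (0 < c)%N &
        linked_entries P1 Q1 rho gamma dl b].
Proof.
move=> k0 Pp Qq rP rQ pq PQ.
have [F [K [L [delta [alpha [FU uK uL rates]]]]]] := linkable_rates PQ.
have [l [c [rho [gamma [dl [b PQ1]]]]]] := rates_linked (Ordinal k0) ord0 rates.
pose gK : GL R d := exist _ K uK; pose gL : GL R d := exist _ L uL.
have Pp1 : represents (P *m K) (config_act gK p) := represents_act gK Pp.
have Qq1 : represents (Q *m L) (config_act gL q) := represents_act gL Qq.
have shP : shape_of (config_act gK p) = shape_of p.
  by apply/esym/shape_ofP; exists gK.
have shQ : shape_of (config_act gL q) = shape_of q.
  by apply/esym/shape_ofP; exists gL.
have row_neq0 (M : 'M[R]_(k, d.+1)) z : represents M z -> forall i, exists j, M i j != 0.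
  by move=> Mz i; have /rV0Pn[j] := represents_row_neq0 i Mz; rewrite mxE; exists j.
have rP1 : \rank (P *m K) = d.+1 by rewrite mxrankMfree // row_free_unit.
have rQ1 : \rank (Q *m L) = d.+1 by rewrite mxrankMfree // row_free_unit.
exists (P *m K), (Q *m L), l, c, rho, gamma, dl, b; split=> //.
- by split; [exists (config_act gK p) | exists (config_act gL q)].
- by split; [exact: row_neq0 Pp1 | exact: row_neq0 Qq1].
(* With a single block row or block column, [Q *m L] would be a rescaling of [P *m K], contradicting
   that the shapes differ. *)
apply/andP; rewrite !lt0n -negb_or; apply/negP => lc0; apply: pq.
have QE := linked_single_block PQ1 (row_neq0 _ _ Pp1) (row_neq0 _ _ Qq1)
  (fun j => full_col_rank_neq0 j rP1) (fun j => full_col_rank_neq0 j rQ1) lc0.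
have [_ [dl0 b0] _ _] := PQ1.
rewrite -shP -shQ; apply/(same_shapeP Pp1 Qq1).
exists (\row_i dl i), (diag_mx (\row_j b j)); split.
- by move=> i; rewrite mxE.
- by rewrite unitmxE det_diag unitfE; apply/prodf_neq0 => j _; rewrite mxE.
- by apply/matrixP => i j; rewrite QE mul_mx_diag mxE mul_diag_mx !mxE.
Qed.

(** [I] consists of the rows outside the first block row and [J] of the columns in the first block
    column. The rows of [P] in [I] are supported off [J], the other rows of [Q] on [J], and the two
    rank bounds add up to $d+1$. *)
Lemma linked_entries_constraints (R : realType) d k l c (P Q : 'M[R]_(k, d.+1))
    (p q : config R d k) (rho : 'I_k -> 'I_l.+1) (gamma : 'I_d.+1 -> 'I_c.+1) dl b :
  represents P p -> represents Q q ->
  (forall i, exists j, P i j != 0) -> (forall i, exists j, Q i j != 0) ->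
  \rank P = d.+1 -> \rank Q = d.+1 -> (0 < c)%N ->
  linked_entries P Q rho gamma dl b ->
  exists (I : {set 'I_k}) (j : nat), constraints p (I, j) /\
    constraints q (~: I, d.+1 - j)%N.
Proof.
move=> Pp Qq rowP rowQ rP rQ c0 PQ.
have colP j := full_col_rank_neq0 j rP; have colQ j := full_col_rank_neq0 j rQ.
pose I := [set i | rho i != ord0]%SET; pose J := [set j | gamma j == ord0]%SET.
have [[_ gamma_surj] _ _ _] := PQ.
have J0 : (0 < #|J|)%N.
  by have [j j0] := gamma_surj ord0; apply/card_gt0P; exists j; rewrite inE j0.
have Jd : (#|~: J| + #|J| = d.+1)%N by rewrite addnC cardsC card_ord.
have JC0 : (0 < #|~: J|)%N.
  have [j j1] := gamma_surj ord_max; apply/card_gt0P; exists j; rewrite !inE j1.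
  by rewrite -val_eqE /= -lt0n.
have rkP : (rk p I <= #|~: J|)%N.
  rewrite (rk_represents I Pp); apply: mxrank_support_cols => i j.
  rewrite !inE negbK mxE => /eqP j0; apply: (linked_first_col PQ rowQ j0).
  by have := enum_valP i; rewrite inE.
have rkQ : (rk q (~: I) <= #|J|)%N.
  rewrite (rk_represents _ Qq); apply: mxrank_support_cols => i j.
  rewrite inE mxE => j0; apply: (linked_first_row PQ colP _ j0).
  by have := enum_valP i; rewrite !inE negbK => /eqP.
(* Full rank supplies the size conditions: $d+1$ is at most the rank of the constrained rows plus
   the number of remaining rows. *)
have cardIC : (#|J| <= #|~: I|)%N.
  have := mxrank_split_rows P I; rewrite rP -(rk_represents I Pp).
  move=> /leq_trans/(_ (leq_add rkP (leqnn _))).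
  by rewrite -[X in (X <= _)%N]Jd leq_add2l.
have cardI : (#|~: J| <= #|I|)%N.
  have := mxrank_split_rows Q (~: I); rewrite rQ -(rk_represents _ Qq) finset.setCK.
  move=> /leq_trans/(_ (leq_add rkQ (leqnn _))).
  by rewrite -[X in (X <= _)%N]Jd addnC leq_add2l.
have JCE : (d.+1 - #|~: J|)%N = #|J| by rewrite -[X in (X - _)%N]Jd addKn.
have JC_lt : (#|~: J| < d.+1)%N by rewrite -subn_gt0 JCE.
exists I, #|~: J|; rewrite JCE; split; split=> //=; first by rewrite JC0.
by rewrite J0 -[X in (_ < X)%N]Jd -[X in (X < _)%N]add0n ltn_add2r.
Qed.

Theorem proposition6p1 (R : realType) (d k : nat) (Y : set (shapes R d k)) :
  (1 <= d)%N -> (d + 3 <= k)%N ->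
  general_shapes R d k `<=` Y -> Y `<=` full_rank_shapes R d k ->
  (~ hausdorff_space (set_type Y) ->
     exists (p q : config R d k) (I : {set 'I_k}) (j : nat),
       [/\ Y (shape_of p), Y (shape_of q), shape_of p <> shape_of q,
           constraints p (I, j) & constraints q (~: I, d.+1 - j)%N])
  /\
  (~ hausdorff_space (set_type Y) <->
     exists x y : shapes R d k,
       [/\ Y x, Y y, x <> y &
         exists (P0 Q0 : 'M[R]_(k, d.+1)) (sigma : 'S_k)
                (l m : nat) (h : 'I_l.+1 -> nat) (w : 'I_m.+1 -> nat)
                (hk : (\sum_r h r)%N = k) (wd : (\sum_s w s)%N = d.+1)
                (P Q : forall r s, 'M[R]_(h r, w s))
                (D : forall r, 'M[R]_(h r)) (B : forall s, 'M[R]_(w s)),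
           [/\ represents_shape P0 x /\ represents_shape Q0 y,
               row_perm sigma P0 = castmx (hk, wd) (\mxblock_(r, s) P r s)
               /\ row_perm sigma Q0 = castmx (hk, wd) (\mxblock_(r, s) Q r s),
               (1 < l.+1)%N /\ (1 < m.+1)%N,
               (forall r, 0 < h r)%N /\ (forall s, 0 < w s)%N &
               [/\ forall r, is_diag_mx (D r) /\ D r \in unitmx,
                   forall s, B s \in unitmx &
                   linked_blocks P Q D B]]]).
Proof.
move=> d1 dk gY Yf.
have k0 : (0 < k)%N by apply: leq_trans dk; rewrite addnS.
have dltk : (d < k)%N by apply: leq_trans dk; rewrite addnS ltnS leq_addr.
have linked_of_nH : ~ hausdorff_space (set_type Y) ->
    exists x y, [/\ Y x, Y y, x <> y &
      exists (P Q : 'M[R]_(k, d.+1)) (l c : nat)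
        (rho : 'I_k -> 'I_l.+1) (gamma : 'I_d.+1 -> 'I_c.+1)
        (dl : 'I_k -> R) (b : 'I_d.+1 -> R),
        [/\ represents_shape P x /\ represents_shape Q y,
            (forall i, exists j, P i j != 0) /\ (forall i, exists j, Q i j != 0),
            \rank P = d.+1 /\ \rank Q = d.+1,
            (0 < l)%N /\ (0 < c)%N &
            linked_entries P Q rho gamma dl b]].
  move=> /not_hausdorff_subspaceP[x [y [Yx Yy xy insep]]].
  exists x, y; split=> //; move: Yx Yy xy insep.
  have shx : shape_of (repr x) = x by exact: reprK.
  have shy : shape_of (repr y) = y by exact: reprK.
  move: (repr x) (repr y) shx shy => p q <- <- Yp Yq pq insep.
  have Pp := represents_config_mx p; have Qq := represents_config_mx q.
  apply: (linkable_linked_entries k0 Pp Qq _ _ pq).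
  - exact: (full_rank_represents Pp (Yf _ Yp)).
  - exact: (full_rank_represents Qq (Yf _ Yq)).
  apply: (inseparable_linkable Pp Qq) => U V pU qV.
  by have [z [_ Uz Vz]] := insep U V pU qV; exists z.
split; last split.
- move=> /linked_of_nH[x [y [Yx Yy xy [P [Q [l [c [rho [gamma [dl [b]]]]]]]]]]].
  move=> [[[p Pp px] [q Qq qy]] [rowP rowQ] [rP rQ] [_ c0] PQ].
  have [I [j [pI qI]]] := linked_entries_constraints Pp Qq rowP rowQ rP rQ c0 PQ.
  by exists p, q, I, j; rewrite px qy.
- move=> /linked_of_nH[x [y [Yx Yy xy [P [Q [l [c [rho [gamma [dl [b]]]]]]]]]]].
  move=> [[[p Pp px] [q Qq qy]] [rowP rowQ] [rP rQ] [l0 c0] PQ].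
  have colP j := full_col_rank_neq0 j rP; have colQ j := full_col_rank_neq0 j rQ.
  have [h [w [hk [wd [sigma [tau [P' [Q' [D [B [P'E Q'E hw [uD uB] blocks]]]]]]]]]]] :=
    linked_entries_blocks PQ rowP rowQ colP colQ.
  exists x, y; split=> //.
  exists (col_perm tau P), (col_perm tau Q), sigma, l, c, h, w, hk, wd, P', Q', D, B.
  split=> //.
  (* The column permutation is a change of basis and leaves the shape unchanged, so only the rows
     are reordered. *)
  pose g : GL R d := exist _ (perm_mx tau^-1) (unitmx_perm _ _).
  have shape_g z : shape_of (config_act g z) = shape_of z.
    by apply/esym/shape_ofP; exists g.
  split; rewrite col_permE.
    by exists (config_act g p); [exact: (represents_act g Pp) | rewrite shape_g].
  by exists (config_act g q); [exact: (represents_act g Qq) | rewrite shape_g].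
move=> [x [y [Yx Yy xy [P0 [Q0 [sigma [l [m [h [w [hk [wd [P [Q [D [B]]]]]]]]]]]]]]]].
move=> [[[p Pp px] [q Qq qy]] [P0E Q0E] _ _ [uD uB blocks]].
apply/not_hausdorff_subspaceP; exists x, y; split=> // U V; rewrite -px -qy => pU qV.
(* Linkability passes from the block matrices to [P0] and [Q0] by undoing the row permutation. *)
have PQ0 : linkable P0 Q0.
  rewrite -[P0]row_perm1 -[Q0]row_perm1 -(mulVg sigma) !row_permM P0E Q0E.
  by apply/linkable_row_perm/linkable_castmx/linked_blocks_linkable.
have [z [gz Uz Vz]] := linkable_inseparable Pp Qq dltk PQ0 pU qV.
by exists z; split=> //; exact: gY.
Qed.
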